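(* Let $k$ be a commutative ring with identity, let $\mathcal{C}$ be a small category with finitely many objects, and let $\mathfrak{M}:\mathcal{C}\to\mathfrak{Bim}_k$ be a covariant pseudofunctor (a modulation on $\mathcal{C}$). Then the modulated category algebra $\mathfrak{M}[\mathcal{C}]=\bigoplus_{\alpha\in\mathrm{Mor}\,\mathcal{C}}\mathfrak{M}(\alpha)$ is a unital associative $k$-algebra, and, together with the canonical lax transformation $\pi:\underline{\mathfrak{M}[\mathcal{C}]}\to\mathfrak{M}$, it is a 2-limit of $\mathfrak{M}$ in $\mathfrak{Bim}_k$; that is, for every unital associative $k$-algebra $A$ the functor induced by $\pi$ is an equivalence of categories $$\pi_*:\mathrm{Hom}_{\mathfrak{Bim}_k}(A,\mathfrak{M}[\mathcal{C}])\xrightarrow{\ \simeq\ }\mathrm{Hom}_{\mathfrak{Bim}_k^{\mathcal{C}}}(\underline{A},\mathfrak{M}),$$ where the left-hand side is the category of $A$-$\mathfrak{M}[\mathcal{C}]$-bimodules. In particular, the category $\mathrm{Mod}\text{-}\mathfrak{M}[\mathcal{C}]$ of right $\mathfrak{M}[\mathcal{C}]$-modules is equivalent to the category $\mathrm{Rep}_k(\mathcal{C},\mathfrak{M})$ of representations of the modulated category $(\mathcal{C},\mathfrak{M})$. Similarly, if $\mathfrak{W}:\mathcal{C}\to\mathfrak{Bim}_k$ is a contravariant pseudofunctor (a comodulation on $\mathcal{C}$), then the comodulated category algebra $\mathfrak{W}[\mathcal{C}]=\bigoplus_{\alpha\in\mathrm{Mor}\,\mathcal{C}}\mathfrak{W}(\alpha)$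 is a unital associative $k$-algebra and, together with its canonical lax transformation $\pi:\underline{\mathfrak{W}[\mathcal{C}]}\to\mathfrak{W}$, it is a 2-limit of $\mathfrak{W}$: for every unital associative $k$-algebra $A$, $\pi$ induces an equivalence $\pi_*:\mathrm{Hom}_{\mathfrak{Bim}_k}(A,\mathfrak{W}[\mathcal{C}])\xrightarrow{\simeq}\mathrm{Hom}_{\mathfrak{Bim}_k^{\mathcal{C}^{op}}}(\underline{A},\mathfrak{W})$. In particular, $\mathrm{Mod}\text{-}\mathfrak{W}[\mathcal{C}]\simeq\mathrm{Rep}_k(\mathcal{C},\mathfrak{W})$.
   Context: **The 2-category $\mathfrak{Bim}_k$.** Objects are unital associative $k$-algebras; 1-morphisms $A\to B$ are $A$-$B$-bimodules (with $k$ acting centrally); 2-morphisms are bimodule homomorphisms. The composite of $M:A\to B$ and $N:B\to C$ is $N\circ M:=M\otimes_B N:A\to C$. The identity 1-morphism of $A$ is $A$ itself. Thus $\mathrm{Hom}_{\mathfrak{Bim}_k}(A,B)$ is the category of $A$-$B$-bimodules, and $\mathrm{Hom}_{\mathfrak{Bim}_k}(k,B)=\mathrm{Mod}\text{-}B$. **Pseudofunctors** (always strictly unitary). A covariant pseudofunctor $\mathfrak{M}:\mathcal{C}\to\mathfrak{Bim}_k$ consists of: a $k$-algebra $\mathfrak{M}(x)$ for each object $x$; an $\mathfrak{M}(x)$-$\mathfrak{M}(y)$-bimodule $\mathfrak{M}(\alpha)$ for each $\alpha:x\to y$; and for all $\alpha:x\to y$, $\beta:y\to z$ a bimodule isomorphism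 $c_{\beta,\alpha}:\mathfrak{M}(\alpha)\otimes_{\mathfrak{M}(y)}\mathfrak{M}(\beta)\to\mathfrak{M}(\beta\alpha)$; such that $\mathfrak{M}(1_x)=\mathfrak{M}(x)$ as a bimodule, $c_{\alpha,1_x}$ and $c_{1_y,\alpha}$ are the canonical isomorphisms given by the actions, and for $\mu:w\to x$, $\alpha:x\to y$, $\beta:y\to z$ one has $c_{\beta\alpha,\mu}\,(\mathrm{Id}_{\mathfrak{M}(\mu)}\otimes c_{\beta,\alpha})=c_{\beta,\alpha\mu}\,(c_{\alpha,\mu}\otimes\mathrm{Id}_{\mathfrak{M}(\beta)})$. A contravariant pseudofunctor $\mathfrak{W}:\mathcal{C}\to\mathfrak{Bim}_k$ is a covariant pseudofunctor on $\mathcal{C}^{op}$. So $\mathfrak{W}(\alpha)$ is a $\mathfrak{W}(y)$-$\mathfrak{W}(x)$-bimodule for $\alpha:x\to y$, and there are coherent bimodule isomorphisms $c_{\alpha,\beta}:\mathfrak{W}(\beta)\otimes_{\mathfrak{W}(y)}\mathfrak{W}(\alpha)\to\mathfrak{W}(\beta\alpha)$ for $\alpha:x\to y$, $\beta:y\to z$. For a $k$-algebra $A$, the constant pseudofunctor $\underline{A}$ sends every object to $A$ and every morphism to the bimodule $A$, with canonical structure isomorphisms. **Lax transformations and modifications.** For a covariant pseudofunctor $\mathfrak{M}$, $\mathrm{Hom}_{\mathfrak{Bim}_k^{\mathcal{C}}}(\underline{A},\mathfrak{M})$ is the category whose objects are lax transformations $\underline{A}\to\mathfrak{M}$ and whose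 morphisms are modifications. Explicitly, a lax transformation $\mathcal{V}:\underline{A}\to\mathfrak{M}$ consists of an $A$-$\mathfrak{M}(x)$-bimodule $\mathcal{V}(x)$ for each object $x$, and an $A$-$\mathfrak{M}(y)$-bimodule homomorphism $\mathcal{V}(\alpha):\mathcal{V}(x)\otimes_{\mathfrak{M}(x)}\mathfrak{M}(\alpha)\to\mathcal{V}(y)$ for each $\alpha:x\to y$, such that $\mathcal{V}(1_x)$ is the canonical isomorphism $\mathcal{V}(x)\otimes_{\mathfrak{M}(x)}\mathfrak{M}(x)\cong\mathcal{V}(x)$ and $\mathcal{V}(\beta)(\mathcal{V}(\alpha)\otimes\mathrm{Id}_{\mathfrak{M}(\beta)})=\mathcal{V}(\beta\alpha)(\mathrm{Id}_{\mathcal{V}(x)}\otimes c_{\beta,\alpha})$ for composable $\alpha:x\to y$, $\beta:y\to z$. A modification $T:\mathcal{V}\to\mathcal{W}$ consists of $A$-$\mathfrak{M}(x)$-bimodule homomorphisms $T_x:\mathcal{V}(x)\to\mathcal{W}(x)$ with $T_y\mathcal{V}(\alpha)=\mathcal{W}(\alpha)(T_x\otimes\mathrm{Id}_{\mathfrak{M}(\alpha)})$ for all $\alpha:x\to y$. For a contravariant pseudofunctor $\mathfrak{W}$, apply these definitions to $\mathcal{C}^{op}$ (so $\mathcal{V}(\alpha):\mathcal{V}(y)\otimes_{\mathfrak{W}(y)}\mathfrak{W}(\alpha)\to\mathcal{V}(x)$ for $\alpha:x\to y$). **Representations.** A representation of $(\mathcal{C},\mathfrak{M})$ is a lax transformation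 $\underline{k}\to\mathfrak{M}$, and $\mathrm{Rep}_k(\mathcal{C},\mathfrak{M})=\mathrm{Hom}_{\mathfrak{Bim}_k^{\mathcal{C}}}(\underline{k},\mathfrak{M})$. Likewise $\mathrm{Rep}_k(\mathcal{C},\mathfrak{W})=\mathrm{Hom}_{\mathfrak{Bim}_k^{\mathcal{C}^{op}}}(\underline{k},\mathfrak{W})$. **2-limits.** A 2-limit of $\mathfrak{M}$ is a pair $(L,\pi)$, with $L$ an object of $\mathfrak{Bim}_k$ and $\pi:\underline{L}\to\mathfrak{M}$ a lax transformation, such that for each object $A$ of $\mathfrak{Bim}_k$ the functor $\pi_*:\mathrm{Hom}_{\mathfrak{Bim}_k}(A,L)\to\mathrm{Hom}_{\mathfrak{Bim}_k^{\mathcal{C}}}(\underline{A},\mathfrak{M})$ is an equivalence. Here $\pi_*$ sends a bimodule $M$ to the lax transformation with $x\mapsto M\otimes_L\pi(x)$ and $\alpha\mapsto\mathrm{Id}_M\otimes\pi(\alpha)$, and a bimodule homomorphism $\phi$ to the modification $x\mapsto\phi\otimes\mathrm{Id}_{\pi(x)}$. The definition for contravariant $\mathfrak{W}$ is the same with $\mathcal{C}^{op}$ in place of $\mathcal{C}$. **Algebras.** The product on $\mathfrak{M}[\mathcal{C}]$ of $m_\alpha\in\mathfrak{M}(\alpha)$ and $m_\beta\in\mathfrak{M}(\beta)$ is $m_\alpha * m_\beta=c_{\beta,\alpha}(m_\alpha\otimes m_\beta)\in\mathfrak{M}(\beta\alpha)$ if $\mathrm{dom}(\beta)=\mathrm{cod}(\alpha)$,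 and $0$ otherwise. The product on $\mathfrak{W}[\mathcal{C}]$ of $w_\beta\in\mathfrak{W}(\beta)$ and $w_\alpha\in\mathfrak{W}(\alpha)$ is $w_\beta * w_\alpha=c_{\alpha,\beta}(w_\beta\otimes w_\alpha)\in\mathfrak{W}(\beta\alpha)$ if $\mathrm{dom}(\beta)=\mathrm{cod}(\alpha)$, and $0$ otherwise. Both are extended bilinearly. **Canonical $\pi$.** Let $1_{\mathfrak{M}(x)}$ be the identity of $\mathfrak{M}(x)=\mathfrak{M}(1_x)$. For $\mathfrak{M}$: $\pi(x)=\mathfrak{M}[\mathcal{C}]1_{\mathfrak{M}(x)}$, an $\mathfrak{M}[\mathcal{C}]$-$\mathfrak{M}(x)$-bimodule, and for $\alpha:x\to y$ the map $\pi(\alpha):\mathfrak{M}[\mathcal{C}]1_{\mathfrak{M}(x)}\otimes_{\mathfrak{M}(x)}\mathfrak{M}(\alpha)\to\mathfrak{M}[\mathcal{C}]1_{\mathfrak{M}(y)}$ is multiplication. For $\mathfrak{W}$: $\pi(x)=\mathfrak{W}[\mathcal{C}]1_{\mathfrak{W}(x)}$, and for $\alpha:x\to y$ the map $\pi(\alpha):\mathfrak{W}[\mathcal{C}]1_{\mathfrak{W}(y)}\otimes_{\mathfrak{W}(y)}\mathfrak{W}(\alpha)\to\mathfrak{W}[\mathcal{C}]1_{\mathfrak{W}(x)}$ is multiplication. *)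

(* Defs.v *)
From HB Require Import structures.
From mathcomp Require Import all_boot all_order all_algebra.
From mathcomp Require Import boolp classical_sets functions cardinality fsbigop.

Set Implicit Arguments.
Unset Strict Implicit.
Unset Printing Implicit Defensive.

Import GRing.Theory.
Local Open Scope ring_scope.
Local Open Scope quotient_scope.

#[local] Obligation Tactic := idtac.

Section Algebras.
Variable k : comPzRingType.

Record is_ualgebra (V : lmodType k) (one : V) (mul : V -> V -> V) : Prop :=
  IsUAlgebra {
    ua_mulA : associative mul;
    ua_mul1l : left_id one mul;
    ua_mul1r : right_id one mul;
    ua_mulDl : left_distributive mul +%R;
    ua_mulDr : right_distributive mul +%R;
    ua_scaleAl : forall c u v, c *: mul u v = mul (c *: u) v;
    ua_scaleAr : forall c u v, c *: mul u v = mul u (c *: v)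
  }.

(* Not [algType k], which excludes the zero ring: here that ring is the algebra
   of the empty category, and it may be a value of a pseudofunctor. *)
Record ualgType := UAlgType {
  ua_mod : lmodType k;
  ua_one : ua_mod;
  ua_mul : ua_mod -> ua_mod -> ua_mod;
  ua_axioms : is_ualgebra ua_one ua_mul
}.

Definition ua_sort (A : ualgType) : Type := ua_mod A.

End Algebras.

Coercion ua_sort : ualgType >-> Sortclass.

HB.instance Definition _ (k : comPzRingType) (A : ualgType k) :=
  GRing.Lmodule.on (ua_sort A).
HB.instance Definition _ (k : comPzRingType) (A : ualgType k) :=
  GRing.Zmodule_isPzRing.Build (ua_sort A)
    (ua_mulA (ua_axioms A)) (ua_mul1l (ua_axioms A)) (ua_mul1r (ua_axioms A))
    (ua_mulDl (ua_axioms A)) (ua_mulDr (ua_axioms A)).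

Section Bimodules.
Variable k : comPzRingType.

Lemma uscalerAl (A : ualgType k) (c : k) (a b : A) : c *: (a * b) = (c *: a) * b.
Proof. exact: (ua_scaleAl (ua_axioms A)). Qed.
Lemma uscalerAr (A : ualgType k) (c : k) (a b : A) : c *: (a * b) = a * (c *: b).
Proof. exact: (ua_scaleAr (ua_axioms A)). Qed.

Definition base_ualg : ualgType k :=
  @UAlgType k k^o 1 (fun a b : k => a * b)
    (@IsUAlgebra k k^o 1 (fun a b : k => a * b)
      (@mulrA k) (@mul1r k) (@mulr1 k) (@mulrDl k) (@mulrDr k)
      (fun c a b : k => mulrA c a b) (fun c a b : k => mulrCA c a b)).

(* An A-B-bimodule on which k acts centrally: [bim_scalel] and [bim_scaler]
   make (c *: 1) m = c *: m = m (c *: 1). *)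
Record bimodule (A B : ualgType k) := Bimodule {
  bim_sort :> lmodType k;
  lact : A -> bim_sort -> bim_sort;
  ract : bim_sort -> B -> bim_sort;
  lact1 : forall m, lact 1 m = m;
  lactM : forall a b m, lact (a * b) m = lact a (lact b m);
  lactDl : forall a b m, lact (a + b) m = lact a m + lact b m;
  lactDr : forall a m n, lact a (m + n) = lact a m + lact a n;
  lactZl : forall c a m, lact (c *: a) m = c *: lact a m;
  lactZr : forall c a m, lact a (c *: m) = c *: lact a m;
  ract1 : forall m, ract m 1 = m;
  ractM : forall m a b, ract m (a * b) = ract (ract m a) b;
  ractDl : forall m n a, ract (m + n) a = ract m a + ract n a;
  ractDr : forall m a b, ract m (a + b) = ract m a + ract m b;
  ractZl : forall c m b, ract (c *: m) b = c *: ract m b;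
  ractZr : forall c m b, ract m (c *: b) = c *: ract m b;
  lractA : forall a m b, lact a (ract m b) = ract (lact a m) b
}.

Record bimod_hom (A B : ualgType k) (M N : bimodule A B) := BimodHom {
  bhom_fun :> M -> N;
  bhom_linear : linear bhom_fun;
  bhom_lact : forall a m, bhom_fun (lact a m) = lact a (bhom_fun m);
  bhom_ract : forall m b, bhom_fun (ract m b) = ract (bhom_fun m) b
}.

HB.instance Definition _ A B (M N : bimodule A B) (f : bimod_hom M N) :=
  GRing.isLinear.Build k M N *:%R (bhom_fun f) (bhom_linear f).

Lemma bhom_ext A B (M N : bimodule A B) (f g : bimod_hom M N) : f =1 g -> f = g.
Proof.
case: f g => [f f1 f2 f3] [g g1 g2 g3] /= /funext e; subst g.
by congr BimodHom; apply: Prop_irrelevance.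
Qed.

Lemma lact0 A B (M : bimodule A B) (a : A) : lact a (0 : M) = 0.
Proof. by rewrite -(scale0r (0 : M)) lactZr !scale0r. Qed.
Lemma ract0 A B (M : bimodule A B) (b : B) : ract (0 : M) b = 0.
Proof. by rewrite -(scale0r (0 : M)) ractZl !scale0r. Qed.

Definition bhom_id A B (M : bimodule A B) : bimod_hom M M :=
  @BimodHom A B M M id (fun _ _ _ => erefl) (fun _ _ => erefl) (fun _ _ => erefl).

Program Definition bhom_comp A B (M N P : bimodule A B)
  (g : bimod_hom N P) (f : bimod_hom M N) : bimod_hom M P :=
  @BimodHom A B M P (g \o f) _ _ _.
Next Obligation. by move=> A B M N P g f c u v /=; rewrite !linearP. Qed.
Next Obligation. by move=> A B M N P g f a m /=; rewrite !bhom_lact. Qed.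
Next Obligation. by move=> A B M N P g f a m /=; rewrite !bhom_ract. Qed.

Lemma bhom_idE A B (M : bimodule A B) m : bhom_id M m = m.
Proof. by []. Qed.

Lemma bhom_compE A B (M N P : bimodule A B) (g : bimod_hom N P)
  (f : bimod_hom M N) m : bhom_comp g f m = g (f m).
Proof. by []. Qed.

Lemma bhom_eqE A B (M N : bimodule A B) (f g : bimod_hom M N) m :
  f = g -> f m = g m.
Proof. by move->. Qed.

Definition is_bimod_iso A B (M N : bimodule A B) (f : bimod_hom M N) : Prop :=
  exists g : bimod_hom N M, bhom_comp g f = bhom_id M /\ bhom_comp f g = bhom_id N.

Definition bhom_of_eq A B (M N : bimodule A B) (e : M = N) : bimod_hom M N :=
  let: erefl in _ = N' := e return bimod_hom M N' in bhom_id M.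

Lemma bhom_of_eqK A B (N P : bimodule A B) (e : N = P) (m : P) :
  bhom_of_eq e (bhom_of_eq (esym e) m) = m.
Proof. by case: P / e m. Qed.
Lemma bhom_of_eqVK A B (N P : bimodule A B) (e : N = P) (m : N) :
  bhom_of_eq (esym e) (bhom_of_eq e m) = m.
Proof. by case: P / e. Qed.

Program Definition regular_bimodule (A : ualgType k) : bimodule A A :=
  @Bimodule A A A (fun a m => a * m) (fun m b => m * b)
    (@mul1r A) _ _ _ _ _ (@mulr1 A) _ _ _ _ _ _.
Next Obligation. by move=> A a b m /=; rewrite mulrA. Qed.
Next Obligation. by move=> A a b m /=; rewrite mulrDl. Qed.
Next Obligation. by move=> A a b m /=; rewrite mulrDr. Qed.
Next Obligation. by move=> A a b m /=; rewrite uscalerAl. Qed.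
Next Obligation. by move=> A a b m /=; rewrite uscalerAr. Qed.
Next Obligation. by move=> A a b m /=; rewrite mulrA. Qed.
Next Obligation. by move=> A a b m /=; rewrite mulrDl. Qed.
Next Obligation. by move=> A a b m /=; rewrite mulrDr. Qed.
Next Obligation. by move=> A a b m /=; rewrite uscalerAl. Qed.
Next Obligation. by move=> A a b m /=; rewrite uscalerAr. Qed.
Next Obligation. by move=> A a b m /=; rewrite mulrA. Qed.

End Bimodules.

#[global] Opaque bhom_id bhom_comp.

Section Tensor.
Variables (k : comPzRingType) (A B D : ualgType k).
Variables (M : bimodule A B) (N : bimodule B D).

(* Tensors over B are the finite formal sums of pairs, modulo the congruence
   generated by biadditivity and B-balancedness; the pair (- m, n) serves as
   the opposite of (m, n), so no formal negatives are needed. *)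
Inductive tensor_rel : seq (M * N) -> seq (M * N) -> Prop :=
| TensorRefl s : tensor_rel s s
| TensorSym s t : tensor_rel s t -> tensor_rel t s
| TensorTrans s t u : tensor_rel s t -> tensor_rel t u -> tensor_rel s u
| TensorCat s t s' t' :
    tensor_rel s t -> tensor_rel s' t' -> tensor_rel (s ++ s') (t ++ t')
| TensorComm s t : tensor_rel (s ++ t) (t ++ s)
| TensorDl m m' n : tensor_rel [:: (m + m', n)] [:: (m, n); (m', n)]
| TensorDr m n n' : tensor_rel [:: (m, n + n')] [:: (m, n); (m, n')]
| Tensor0l n : tensor_rel [:: (0, n)] [::]
| TensorBal m b n : tensor_rel [:: (ract m b, n)] [:: (m, lact b n)].

Let trel : rel (seq (M * N)) := fun s t => `[< tensor_rel s t >].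

Fact tensor_rel_equiv : equiv_class_of trel.
Proof.
split.
- by move=> s; apply/asboolP; exact: TensorRefl.
- by move=> s t; apply/asboolP/asboolP; apply: TensorSym.
- move=> t s u /asboolP h1 /asboolP h2; apply/asboolP; exact: TensorTrans h1 h2.
Qed.

Canonical tensor_equiv := EquivRelPack tensor_rel_equiv.

Definition tensor_type : Type := {eq_quot tensor_equiv}.
HB.instance Definition _ := Choice.on tensor_type.

Let cls (s : seq (M * N)) : tensor_type := \pi_({eq_quot tensor_equiv}) s.
Let rpr (x : tensor_type) : seq (M * N) := repr (x : {eq_quot tensor_equiv}).

Let clsP s t : cls s = cls t <-> tensor_rel s t.
Proof.
split; first by move=> /eqmodP /asboolP.
by move=> h; apply/eqmodP/asboolP.
Qed.

Let rprK x : cls (rpr x) = x. Proof. exact: reprK. Qed.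
Let rprP s : tensor_rel (rpr (cls s)) s. Proof. by apply/clsP; rewrite rprK. Qed.

Let tadd x y := cls (rpr x ++ rpr y).
Let tzero := cls [::].
Let topp x := cls [seq (- p.1, p.2) | p <- rpr x].

Let tadd_cls s t : tadd (cls s) (cls t) = cls (s ++ t).
Proof. by apply/clsP/TensorCat; apply: rprP. Qed.

Fact tensor_addA : associative tadd.
Proof.
move=> x y z; rewrite -(rprK x) -(rprK y) -(rprK z).
by rewrite !tadd_cls catA.
Qed.
Fact tensor_addC : commutative tadd.
Proof.
move=> x y; rewrite -(rprK x) -(rprK y) !tadd_cls.
by apply/clsP/TensorComm.
Qed.
Fact tensor_add0 : left_id tzero tadd.
Proof. by move=> x; rewrite -(rprK x) tadd_cls. Qed.
Fact tensor_addN : left_inverse tzero topp tadd.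
Proof.
move=> x; rewrite -{2}(rprK x) tadd_cls; apply/clsP.
elim: (rpr x) => [|[m n] s IH] /=; first exact: TensorRefl.
set t := map _ _ in IH *.
have h : tensor_rel [:: (- m, n); (m, n)] [::].
  apply: TensorTrans (Tensor0l n); rewrite -(addNr m).
  exact/TensorSym/TensorDl.
rewrite -cat1s -[_ :: s]cat1s.
apply: TensorTrans (_ : tensor_rel _ ([:: (- m, n); (m, n)] ++ (t ++ s))) _.
  rewrite -[[:: _; _]]/([:: (- m, n)] ++ [:: (m, n)]) -!catA.
  apply: TensorCat; first exact: TensorRefl.
  rewrite !catA; apply: TensorCat; last exact: TensorRefl.
  exact: TensorComm.
by rewrite -[X in tensor_rel _ X]cats0; apply: TensorCat h IH.
Qed.

HB.instance Definition _ := GRing.isZmodule.Build tensor_type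
  tensor_addA tensor_addC tensor_add0 tensor_addN.

Definition gen (m : M) (n : N) : tensor_type := cls [:: (m, n)].

Record balanced (P : zmodType) (f : M -> N -> P) : Prop := Balanced {
  balDl : forall m m' n, f (m + m') n = f m n + f m' n;
  balDr : forall m n n', f m (n + n') = f m n + f m n';
  balA : forall m b n, f (ract m b) n = f m (lact b n)
}.

Definition tlift (P : zmodType) (f : M -> N -> P) (x : tensor_type) : P :=
  \sum_(p <- rpr x) f p.1 p.2.

Section Lift.
Variables (P : zmodType) (f : M -> N -> P) (fP : balanced f).

Let f0 n : f 0 n = 0.
Proof. by apply: (addrI (f 0 n)); rewrite -(balDl fP) !addr0. Qed.

Let tlift_cls s : tlift f (cls s) = \sum_(p <- s) f p.1 p.2.
Proof.
suff h t u : tensor_rel t u -> \sum_(p <- t) f p.1 p.2 = \sum_(p <- u) f p.1 p.2.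
  exact: h (rprP s).
elim=> {t u} //=.
- by move=> ? ? ? _ -> _ ->.
- by move=> ? ? ? ? _ IH1 _ IH2; rewrite !big_cat /= IH1 IH2.
- by move=> ? ?; rewrite !big_cat /= addrC.
- by move=> m m' n; rewrite !big_cons !big_nil !addr0 (balDl fP).
- by move=> m n n'; rewrite !big_cons !big_nil !addr0 (balDr fP).
- by move=> n; rewrite big_cons !big_nil addr0 f0.
- by move=> m b n; rewrite !big_cons !big_nil !addr0 (balA fP).
Qed.

Lemma tlift_gen m n : tlift f (gen m n) = f m n.
Proof. by rewrite tlift_cls big_seq1. Qed.

Lemma tliftD x y : tlift f (x + y) = tlift f x + tlift f y.
Proof. by rewrite -(rprK x) -(rprK y) [cls _ + _]tadd_cls !tlift_cls big_cat. Qed.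

End Lift.

Lemma gen_ind (Q : tensor_type -> Prop) :
  Q 0 -> (forall m n x, Q x -> Q (gen m n + x)) -> forall x, Q x.
Proof.
move=> Q0 Qa x; rewrite -(rprK x); elim: (rpr x) => [|[m n] s IH] //.
by rewrite -cat1s -tadd_cls; apply: Qa.
Qed.

Lemma gen_ext (P : zmodType) (f g : tensor_type -> P) :
  {morph f : x y / x + y} -> {morph g : x y / x + y} ->
  (forall m n, f (gen m n) = g (gen m n)) -> f =1 g.
Proof.
move=> fD gD e; apply: gen_ind => [|m n x IH]; last by rewrite fD gD e IH.
have z (h : tensor_type -> P) : {morph h : x y / x + y} -> h 0 = 0.
  by move=> hD; apply: (addrI (h 0)); rewrite -hD !addr0.
by rewrite (z _ fD) (z _ gD).
Qed.

Lemma gen_balanced : balanced gen.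
Proof.
split=> *.
- by rewrite [RHS]tadd_cls; apply/clsP/TensorDl.
- by rewrite [RHS]tadd_cls; apply/clsP/TensorDr.
- exact/clsP/TensorBal.
Qed.

Lemma genDl m m' n : gen (m + m') n = gen m n + gen m' n.
Proof. exact: balDl gen_balanced m m' n. Qed.
Lemma genDr m n n' : gen m (n + n') = gen m n + gen m n'.
Proof. exact: balDr gen_balanced m n n'. Qed.
Lemma genA m b n : gen (ract m b) n = gen m (lact b n).
Proof. exact: balA gen_balanced m b n. Qed.

Let tscale (c : k) := tlift (fun m n => gen (c *: m) n).
Let tscale_bal c : balanced (fun m n => gen (c *: m) n).
Proof.
split=> *; first by rewrite scalerDr genDl.
  by rewrite genDr.
by rewrite -ractZl genA.
Qed.
Let tscale_pure c m n : tscale c (gen m n) = gen (c *: m) n.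
Proof. exact: tlift_gen (tscale_bal c) m n. Qed.
Let tscaleDr : right_distributive tscale +%R.
Proof. by move=> c x y; apply: tliftD (tscale_bal c) x y. Qed.

Fact tensor_scaleA a b x : tscale a (tscale b x) = tscale (a * b) x.
Proof.
move: x; apply: gen_ext => [x y|x y|m n]; rewrite ?tscaleDr //.
by rewrite !tscale_pure scalerA.
Qed.
Fact tensor_scale1 : left_id 1 tscale.
Proof.
apply: gen_ext => [x y|x y|m n]; rewrite ?tscaleDr //.
by rewrite !tscale_pure scale1r.
Qed.
Fact tensor_scaleDl x : {morph tscale^~ x : a b / a + b}.
Proof.
move=> a b; move: x.
apply: (@gen_ext _ (tscale (a + b)) (fun x => tscale a x + tscale b x)) => [x y|x y|m n].
- by rewrite tscaleDr.
- by rewrite !tscaleDr addrACA.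
by rewrite !tscale_pure scalerDl genDl.
Qed.

HB.instance Definition _ := GRing.Zmodule_isLmodule.Build k tensor_type
  tensor_scaleA tensor_scale1 tscaleDr tensor_scaleDl.

Lemma genZl c m n : gen (c *: m) n = c *: gen m n.
Proof. by symmetry; exact: tscale_pure. Qed.
Lemma genZr c m n : gen m (c *: n) = c *: gen m n.
Proof.
rewrite -genZl -{1}(lact1 n) -lactZl -genA -{2}(ract1 m) -ractZr //.
Qed.

Lemma tlift_linear (P : lmodType k) (f : M -> N -> P) (fP : balanced f) :
  (forall c m n, f (c *: m) n = c *: f m n) -> linear (tlift f).
Proof.
move=> fZ c x y; rewrite tliftD //; congr (_ + _); move: x.
apply: (@gen_ext _ (fun x => tlift f (c *: x)) (fun x => c *: tlift f x))
  => [x y'|x y'|m n].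
- by rewrite scalerDr tliftD.
- by rewrite tliftD // scalerDr.
by rewrite -genZl !tlift_gen.
Qed.

Let tlact (a : A) := tlift (fun m n => gen (lact a m) n).
Let tract x (d : D) := tlift (fun m n => gen m (ract n d)) x.

Let tlact_bal a : balanced (fun m n => gen (lact a m) n).
Proof.
split=> *; first by rewrite lactDr genDl.
  by rewrite genDr.
by rewrite lractA genA.
Qed.
Let tract_bal d : balanced (fun m n => gen m (ract n d)).
Proof.
split=> *; first by rewrite genDl.
  by rewrite ractDl genDr.
by rewrite genA lractA.
Qed.
Let tlactE a m n : tlact a (gen m n) = gen (lact a m) n.
Proof. exact: tlift_gen (tlact_bal a) m n. Qed.
Let tractE d m n : tract (gen m n) d = gen m (ract n d).
Proof. exact: tlift_gen (tract_bal d) m n. Qed.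
Let tlactD a x y : tlact a (x + y) = tlact a x + tlact a y.
Proof. exact: tliftD (tlact_bal a) x y. Qed.
Let tractD d x y : tract (x + y) d = tract x d + tract y d.
Proof. exact: tliftD (tract_bal d) x y. Qed.


Definition tensor : bimodule A D.
Proof.
refine (@Bimodule k A D tensor_type tlact tract
  _ _ _ tlactD _ _ _ _ (fun x y d => tractD d x y) _ _ _ _).
- by apply: gen_ext => [x y|x y|m n]; rewrite ?tlactD // tlactE lact1.
- move=> a b; apply: gen_ext => [x y|x y|m n]; rewrite ?tlactD //.
  by rewrite !tlactE lactM.
- move=> a b; apply: (@gen_ext _ (tlact (a + b)) (fun x => tlact a x + tlact b x))
    => [x y|x y|m n].
  + by rewrite !tlactD.
  + by rewrite !tlactD addrACA.
  + by rewrite !tlactE lactDl genDl.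
- move=> c a; apply: (@gen_ext _ (tlact (c *: a)) (fun x => c *: tlact a x))
    => [x y|x y|m n].
  + by rewrite !tlactD.
  + by rewrite !tlactD scalerDr.
  + by rewrite !tlactE lactZl genZl.
- move=> c a; apply: (@gen_ext _ (fun x => tlact a (c *: x)) (fun x => c *: tlact a x))
    => [x y|x y|m n].
  + by rewrite scalerDr !tlactD.
  + by rewrite !tlactD scalerDr.
  + by rewrite -genZl !tlactE lactZr genZl.
- apply: (@gen_ext _ (fun x => tract x 1) id) => [x y|x y|m n]; rewrite ?tractD //.
  by rewrite tractE ract1.
- move=> x a b; move: x.
  apply: (@gen_ext _ (fun x => tract x (a * b)) (fun x => tract (tract x a) b))
    => [x y|x y|m n]; rewrite ?tractD //.
  by rewrite !tractE ractM.
- move=> x a b; move: x.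
  apply: (@gen_ext _ (fun x => tract x (a + b)) (fun x => tract x a + tract x b))
    => [x y|x y|m n].
  + by rewrite !tractD.
  + by rewrite !tractD addrACA.
  + by rewrite !tractE ractDr genDr.
- move=> c x b; move: x.
  apply: (@gen_ext _ (fun x => tract (c *: x) b) (fun x => c *: tract x b))
    => [x y|x y|m n].
  + by rewrite scalerDr !tractD.
  + by rewrite !tractD scalerDr.
  + by rewrite -genZl !tractE genZl.
- move=> c x b; move: x.
  apply: (@gen_ext _ (fun x => tract x (c *: b)) (fun x => c *: tract x b))
    => [x y|x y|m n].
  + by rewrite !tractD.
  + by rewrite !tractD scalerDr.
  + by rewrite !tractE ractZr genZr.
- move=> a x b; move: x.
  apply: (@gen_ext _ (fun x => tlact a (tract x b)) (fun x => tract (tlact a x) b))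
    => [x y|x y|m n].
  + by rewrite tractD tlactD.
  + by rewrite tlactD tractD.
  + by rewrite !(tractE, tlactE).
Defined.

Definition pure (m : M) (n : N) : tensor := gen m n.

Lemma pureDl m m' n : pure (m + m') n = pure m n + pure m' n.
Proof. exact: genDl. Qed.
Lemma pureDr m n n' : pure m (n + n') = pure m n + pure m n'.
Proof. exact: genDr. Qed.
Lemma pureA m b n : pure (ract m b) n = pure m (lact b n).
Proof. exact: genA. Qed.
Lemma pureZl c m n : pure (c *: m) n = c *: pure m n.
Proof. exact: genZl. Qed.
Lemma pureZr c m n : pure m (c *: n) = c *: pure m n.
Proof. exact: genZr. Qed.

Lemma tensor_ind (Q : tensor -> Prop) :
  Q 0 -> (forall m n x, Q x -> Q (pure m n + x)) -> forall x, Q x.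
Proof. exact: gen_ind. Qed.

Lemma tensor_ext (P : zmodType) (f g : tensor -> P) :
  {morph f : x y / x + y} -> {morph g : x y / x + y} ->
  (forall m n, f (pure m n) = g (pure m n)) -> f =1 g.
Proof. exact: gen_ext. Qed.

Lemma lact_pure (a : A) m n :
  lact a (pure m n) = pure (lact a m) n.
Proof. exact: tlactE. Qed.
Lemma ract_pure m n (d : D) :
  ract (pure m n) d = pure m (ract n d).
Proof. exact: tractE. Qed.

Lemma bhom_tensor_ext (P : bimodule A D) (f g : bimod_hom tensor P) :
  (forall m n, f (pure m n) = g (pure m n)) -> f = g.
Proof.
move=> e; apply: bhom_ext; apply: tensor_ext => // x y; exact: (raddfD (_ : bimod_hom _ _)).
Qed.

Record bilinear_balanced (P : bimodule A D) (f : M -> N -> P) : Prop :=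
  BilinearBalanced {
    bb_balanced :> balanced f;
    bb_lact : forall a m n, f (lact a m) n = lact a (f m n);
    bb_ract : forall m n d, f m (ract n d) = ract (f m n) d
  }.

Lemma bb_scale (P : bimodule A D) (f : M -> N -> P) :
  bilinear_balanced f -> forall c m n, f (c *: m) n = c *: f m n.
Proof.
move=> fP c m n; rewrite -{1}(lact1 m) -lactZl (bb_lact fP) lactZl.
by rewrite lact1.
Qed.

Definition tensor_hom (P : bimodule A D) (f : M -> N -> P)
  (fP : bilinear_balanced f) : bimod_hom tensor P.
Proof.
refine (@BimodHom k A D tensor P (tlift f)
  (tlift_linear (bb_balanced fP) (bb_scale fP)) _ _).
- move=> a; apply: (@gen_ext _ (fun x => tlift f (tlact a x))
    (fun x => lact a (tlift f x))) => [x y|x y|m n].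
  + by rewrite tlactD tliftD //; apply: fP.
  + by rewrite tliftD ?lactDr //; apply: fP.
  + by rewrite tlactE !(tlift_gen fP) (bb_lact fP).
- move=> x d; move: x; apply: (@gen_ext _ (fun x => tlift f (tract x d))
    (fun x => ract (tlift f x) d)) => [x y|x y|m n].
  + by rewrite tractD tliftD //; apply: fP.
  + by rewrite tliftD ?ractDl //; apply: fP.
  + by rewrite tractE !(tlift_gen fP) (bb_ract fP).
Defined.

Lemma tensor_hom_pure (P : bimodule A D) (f : M -> N -> P)
  (fP : bilinear_balanced f) m n : tensor_hom fP (pure m n) = f m n.
Proof. exact: tlift_gen fP m n. Qed.

End Tensor.

Notation "M ⊗ N" := (tensor M N) (at level 40, left associativity).

Section TensorCalculus.
Variable k : comPzRingType.

Fact tensor_map_subproof (A B D : ualgType k) (M M' : bimodule A B)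
    (N N' : bimodule B D) (f : bimod_hom M M') (g : bimod_hom N N') :
  @bilinear_balanced _ _ _ _ M N (M' ⊗ N') (fun m n => pure (f m) (g n)).
Proof.
split; first split.
- by move=> m m' n; rewrite linearD pureDl.
- by move=> m n n'; rewrite linearD pureDr.
- by move=> m b n; rewrite bhom_ract bhom_lact pureA.
- by move=> a m n; rewrite bhom_lact lact_pure.
- by move=> m n d; rewrite bhom_ract ract_pure.
Qed.

Definition tensor_map (A B D : ualgType k) (M M' : bimodule A B)
    (N N' : bimodule B D) (f : bimod_hom M M') (g : bimod_hom N N') :
  bimod_hom (M ⊗ N) (M' ⊗ N') := tensor_hom (tensor_map_subproof f g).

Lemma tensor_map_pure (A B D : ualgType k) (M M' : bimodule A B)
    (N N' : bimodule B D) (f : bimod_hom M M') (g : bimod_hom N N') m n :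
  tensor_map f g (pure m n) = pure (f m) (g n).
Proof. exact: tensor_hom_pure. Qed.

Fact lunitor_subproof (A B : ualgType k) (M : bimodule A B) :
  @bilinear_balanced _ _ _ _ (regular_bimodule A) M M (fun a m => lact a m).
Proof.
split; first split.
- by move=> a b m; rewrite lactDl.
- by move=> a m n; rewrite lactDr.
- by move=> a b m /=; rewrite lactM.
- by move=> a b m /=; rewrite lactM.
- by move=> a m b; rewrite lractA.
Qed.

Definition lunitor (A B : ualgType k) (M : bimodule A B) :
  bimod_hom (regular_bimodule A ⊗ M) M := tensor_hom (lunitor_subproof M).

Lemma lunitor_pure (A B : ualgType k) (M : bimodule A B) (a : A) (m : M) :
  lunitor M (pure (a : regular_bimodule A) m) = lact a m.
Proof. exact: tensor_hom_pure. Qed.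

Fact runitor_subproof (A B : ualgType k) (M : bimodule A B) :
  @bilinear_balanced _ _ _ _ M (regular_bimodule B) M (fun m b => ract m b).
Proof.
split; first split.
- by move=> m n b; rewrite ractDl.
- by move=> m a b; rewrite ractDr.
- by move=> m a b /=; rewrite ractM.
- by move=> a m b /=; rewrite lractA.
- by move=> m a b /=; rewrite ractM.
Qed.

Definition runitor (A B : ualgType k) (M : bimodule A B) :
  bimod_hom (M ⊗ regular_bimodule B) M := tensor_hom (runitor_subproof M).

Lemma runitor_pure (A B : ualgType k) (M : bimodule A B) (m : M) (b : B) :
  runitor M (pure m (b : regular_bimodule B)) = ract m b.
Proof. exact: tensor_hom_pure. Qed.

Section Associator.
Variables (A B D E : ualgType k).
Variables (M : bimodule A B) (N : bimodule B D) (P : bimodule D E).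

Let inner (p : P) (m : M) (n : N) : M ⊗ (N ⊗ P) := pure m (pure n p).

Let inner_bal p : balanced (inner p).
Proof.
split.
- by move=> m m' n; rewrite /inner pureDl.
- by move=> m n n'; rewrite /inner pureDl pureDr.
- by move=> m b n; rewrite /inner pureA lact_pure.
Qed.

Let assoc_fun (x : M ⊗ N) (p : P) : M ⊗ (N ⊗ P) := tlift (inner p) x.

Let assoc_funE m n p : assoc_fun (pure m n) p = pure m (pure n p).
Proof. exact: tlift_gen (inner_bal p) m n. Qed.

Let assoc_funD x y p : assoc_fun (x + y) p = assoc_fun x p + assoc_fun y p.
Proof. exact: tliftD (inner_bal p) x y. Qed.

Fact associator_subproof : bilinear_balanced assoc_fun.
Proof.
split; first split.
- by move=> x y p; rewrite assoc_funD.
- move=> x p q; move: x; apply: (@tensor_ext _ _ _ _ M N _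
    (assoc_fun^~ (p + q)) (fun x => assoc_fun x p + assoc_fun x q)) => [x y|x y|m n].
  + by rewrite assoc_funD.
  + by rewrite !assoc_funD addrACA.
  + by rewrite !assoc_funE !pureDr.
- move=> x d p; move: x; apply: (@tensor_ext _ _ _ _ M N _
    (fun x => assoc_fun (ract x d) p)
    (fun x => assoc_fun x (lact d p))) => [x y|x y|m n].
  + by rewrite ractDl assoc_funD.
  + by rewrite assoc_funD.
  + by rewrite ract_pure !assoc_funE pureA.
- move=> a x p; move: x; apply: (@tensor_ext _ _ _ _ M N _
    (fun x => assoc_fun (lact a x) p)
    (fun x => lact a (assoc_fun x p))) => [x y|x y|m n].
  + by rewrite lactDr assoc_funD.
  + by rewrite assoc_funD lactDr.
  + by rewrite lact_pure !assoc_funE lact_pure.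
- move=> x p d; move: x; apply: (@tensor_ext _ _ _ _ M N _
    (fun x => assoc_fun x (ract p d))
    (fun x => ract (assoc_fun x p) d)) => [x y|x y|m n].
  + by rewrite assoc_funD.
  + by rewrite assoc_funD ractDl.
  + by rewrite !assoc_funE !ract_pure.
Qed.

Definition associator : bimod_hom (M ⊗ N ⊗ P) (M ⊗ (N ⊗ P)) :=
  tensor_hom associator_subproof.

Lemma associator_pure m n p :
  associator (pure (pure m n) p) = pure m (pure n p).
Proof. by rewrite /associator tensor_hom_pure assoc_funE. Qed.

Lemma bhom_tensor3_ext (Q : bimodule A E) (f g : bimod_hom (M ⊗ N ⊗ P) Q) :
  (forall m n p, f (pure (pure m n) p)
               = g (pure (pure m n) p)) -> f = g.
Proof.
move=> e; apply: bhom_tensor_ext => x p; move: x.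
apply: (@tensor_ext _ _ _ _ M N _
  (fun x => f (pure x p))
  (fun x => g (pure x p))) => [x y|x y|m n].
- by rewrite pureDl linearD.
- by rewrite pureDl linearD.
- exact: e.
Qed.

End Associator.

Lemma bhom_tensor4_ext (A B D E F : ualgType k) (M : bimodule A B)
    (N : bimodule B D) (P : bimodule D E) (Q : bimodule E F) (R : bimodule A F)
    (f g : bimod_hom (M ⊗ N ⊗ P ⊗ Q) R) :
  (forall m n p q, f (pure (pure (pure m n) p) q)
                 = g (pure (pure (pure m n) p) q)) -> f = g.
Proof.
move=> e; apply: bhom_tensor_ext => x q; move: x.
apply: tensor_ext => [x y|x y|x p]; rewrite ?pureDl ?linearD //; move: x.
apply: tensor_ext => [x y|x y|m n]; rewrite ?pureDl ?linearD //.
Qed.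

End TensorCalculus.

#[global] Opaque tensor_map lunitor runitor associator.

Record category := Category {
  cat_ob :> Type;
  cat_hom : cat_ob -> cat_ob -> Type;
  cat_id : forall x, cat_hom x x;
  cat_comp : forall x y z, cat_hom y z -> cat_hom x y -> cat_hom x z;
  cat_comp1f : forall x y (f : cat_hom x y), cat_comp (cat_id y) f = f;
  cat_compf1 : forall x y (f : cat_hom x y), cat_comp f (cat_id x) = f;
  cat_compA : forall x y z t
    (h : cat_hom z t) (g : cat_hom y z) (f : cat_hom x y),
    cat_comp h (cat_comp g f) = cat_comp (cat_comp h g) f
}.

Record cfunctor (X Y : category) := CFunctor {
  fun_ob :> X -> Y;
  fun_hom : forall x y, cat_hom x y -> cat_hom (fun_ob x) (fun_ob y);
  fun_id : forall x, fun_hom (cat_id x) = cat_id (fun_ob x);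
  fun_comp : forall x y z (g : cat_hom y z) (f : cat_hom x y),
    fun_hom (cat_comp g f) = cat_comp (fun_hom g) (fun_hom f)
}.

Definition cfunctor_id (X : category) : cfunctor X X :=
  @CFunctor X X id (fun _ _ f => f) (fun _ => erefl) (fun _ _ _ _ _ => erefl).

Program Definition cfunctor_comp (X Y Z : category)
  (G : cfunctor Y Z) (F : cfunctor X Y) : cfunctor X Z :=
  @CFunctor X Z (fun x => G (F x)) (fun _ _ f => fun_hom G (fun_hom F f)) _ _.
Next Obligation. by move=> X Y Z G F x /=; rewrite !fun_id. Qed.
Next Obligation. by move=> X Y Z G F x y z g f /=; rewrite !fun_comp. Qed.

Definition is_cat_iso (X : category) (x y : X) (f : cat_hom x y) : Prop :=
  exists g : cat_hom y x, cat_comp g f = cat_id x /\ cat_comp f g = cat_id y.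

Definition nat_isomorphic (X Y : category) (F G : cfunctor X Y) : Prop :=
  exists t : forall x : X, cat_hom (F x) (G x),
    (forall x, is_cat_iso (t x)) /\
    (forall x y (f : cat_hom x y),
       cat_comp (t y) (fun_hom F f) = cat_comp (fun_hom G f) (t x)).

Definition is_equivalence (X Y : category) (F : cfunctor X Y) : Prop :=
  exists G : cfunctor Y X,
    nat_isomorphic (cfunctor_comp G F) (cfunctor_id X) /\
    nat_isomorphic (cfunctor_comp F G) (cfunctor_id Y).

Definition equivalent_categories (X Y : category) : Prop :=
  exists F : cfunctor X Y, is_equivalence F.

Definition bhomE := (bhom_idE, bhom_compE, tensor_map_pure, lunitor_pure,
  runitor_pure, associator_pure).

Section HomBim.
Variable k : comPzRingType.

Program Definition Bimod (A B : ualgType k) : category :=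
  @Category (bimodule A B) (@bimod_hom k A B) (@bhom_id k A B)
    (@bhom_comp k A B) _ _ _.
Next Obligation. by move=> A B M N f; apply: bhom_ext => m; rewrite !bhomE. Qed.
Next Obligation. by move=> A B M N f; apply: bhom_ext => m; rewrite !bhomE. Qed.
Next Obligation. by move=> A B M N P Q f g h; apply: bhom_ext => m; rewrite !bhomE. Qed.

End HomBim.

(* A right R-module is a left module over the converse ring R^c. *)
Section RightModules.
Variable R : pzRingType.

Lemma linear_ext (U V : lmodType R^c) (f g : {linear U -> V}) : f =1 g -> f = g.
Proof.
move=> e; have {}e : (f : U -> V) = g by apply/funext.
case: f e => f [[f1] [f2]]; case: g => g [[g1] [g2]] /= e; subst g.
by rewrite (Prop_irrelevance f1 g1) (Prop_irrelevance f2 g2).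
Qed.

Program Definition RMod : category :=
  @Category (lmodType R^c) (fun U V => {linear U -> V}) (fun U => idfun)
    (fun U V W g f => g \o f) _ _ _.
Next Obligation. by move=> U V f; apply: linear_ext. Qed.
Next Obligation. by move=> U V f; apply: linear_ext. Qed.
Next Obligation. by move=> U V W X h g f; apply: linear_ext. Qed.

End RightModules.

(* A category with finitely many objects; its morphisms need not form a finite
   set. *)
Record finob_category := FinobCategory {
  fc_ob :> finType;
  fc_hom : fc_ob -> fc_ob -> Type;
  fc_id : forall x, fc_hom x x;
  fc_comp : forall x y z, fc_hom y z -> fc_hom x y -> fc_hom x z;
  fc_comp1f : forall x y (a : fc_hom x y), fc_comp (fc_id y) a = a;
  fc_compf1 : forall x y (a : fc_hom x y), fc_comp a (fc_id x) = a;
  fc_compA : forall w x y z (c : fc_hom y z) (b : fc_hom x y) (a : fc_hom w x),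
    fc_comp c (fc_comp b a) = fc_comp (fc_comp c b) a
}.

Definition fc_op (C : finob_category) : finob_category :=
  @FinobCategory C (fun x y => fc_hom y x) (@fc_id C)
    (fun x y z b a => fc_comp a b)
    (fun x y a => fc_compf1 a) (fun x y a => fc_comp1f a)
    (fun w x y z c b a => esym (fc_compA a b c)).

(* The transports [bhom_of_eq] along the unit and associativity laws of C
   are identities on paper. *)
Record pseudofunctor (k : comPzRingType) (C : finob_category) := Pseudofunctor {
  ps_ob :> C -> ualgType k;
  ps_hom : forall x y, fc_hom x y -> bimodule (ps_ob x) (ps_ob y);
  ps_comp : forall x y z (b : fc_hom y z) (a : fc_hom x y),
    bimod_hom (ps_hom a ⊗ ps_hom b) (ps_hom (fc_comp b a));
  ps_comp_iso : forall x y z (b : fc_hom y z) (a : fc_hom x y),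
    is_bimod_iso (ps_comp b a);
  ps_id : forall x, ps_hom (fc_id x) = regular_bimodule (ps_ob x);
  ps_compf1 : forall x y (a : fc_hom x y),
    bhom_comp (bhom_of_eq (congr1 (@ps_hom x y) (fc_compf1 a)))
              (ps_comp a (fc_id x)) =
    bhom_comp (lunitor (ps_hom a))
              (tensor_map (bhom_of_eq (ps_id x)) (bhom_id (ps_hom a)));
  ps_comp1f : forall x y (a : fc_hom x y),
    bhom_comp (bhom_of_eq (congr1 (@ps_hom x y) (fc_comp1f a)))
              (ps_comp (fc_id y) a) =
    bhom_comp (runitor (ps_hom a))
              (tensor_map (bhom_id (ps_hom a)) (bhom_of_eq (ps_id y)));
  ps_compA : forall w x y z (b : fc_hom y z) (a : fc_hom x y) (m : fc_hom w x),
    bhom_comp (ps_comp (fc_comp b a) m)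
      (bhom_comp (tensor_map (bhom_id (ps_hom m)) (ps_comp b a))
                 (associator (ps_hom m) (ps_hom a) (ps_hom b))) =
    bhom_comp (bhom_of_eq (congr1 (@ps_hom w z) (fc_compA b a m)))
      (bhom_comp (ps_comp b (fc_comp a m))
                 (tensor_map (ps_comp a m) (bhom_id (ps_hom b))))
}.

Definition modulation (k : comPzRingType) (C : finob_category) :=
  pseudofunctor k C.
Definition comodulation (k : comPzRingType) (C : finob_category) :=
  pseudofunctor k (fc_op C).

Section LaxTransformations.
Variables (k : comPzRingType) (C : finob_category).

(* A lax transformation from the constant pseudofunctor A to M. *)
Record lax_transformation (A : ualgType k) (M : pseudofunctor k C) :=
  LaxTransformation {
    lax_ob :> forall x, bimodule A (M x);
    lax_hom : forall x y (a : fc_hom x y),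
      bimod_hom (lax_ob x ⊗ ps_hom M a) (lax_ob y);
    lax_id : forall x, lax_hom (fc_id x) =
      bhom_comp (runitor (lax_ob x))
                (tensor_map (bhom_id (lax_ob x)) (bhom_of_eq (ps_id M x)));
    lax_comp : forall x y z (b : fc_hom y z) (a : fc_hom x y),
      bhom_comp (lax_hom b) (tensor_map (lax_hom a) (bhom_id (ps_hom M b))) =
      bhom_comp (lax_hom (fc_comp b a))
        (bhom_comp (tensor_map (bhom_id (lax_ob x)) (ps_comp M b a))
                   (associator (lax_ob x) (ps_hom M a) (ps_hom M b)))
  }.

Record modification (A : ualgType k) (M : pseudofunctor k C)
    (V W : lax_transformation A M) := Modification {
  mdf_fun :> forall x, bimod_hom (V x) (W x);
  mdf_nat : forall x y (a : fc_hom x y),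
    bhom_comp (mdf_fun y) (lax_hom V a) =
    bhom_comp (lax_hom W a) (tensor_map (mdf_fun x) (bhom_id (ps_hom M a)))
}.

Section Cat.
Variables (A : ualgType k) (M : pseudofunctor k C).
Implicit Types V W X : lax_transformation A M.

Lemma modification_ext V W (S T : modification V W) :
  (forall x, S x = T x) -> S = T.
Proof.
case: S T => [S S1] [T T1] /= e.
have {}e : S = T by apply: functional_extensionality_dep.
by subst T; rewrite (Prop_irrelevance S1 T1).
Qed.

Program Definition modification_id V : modification V V :=
  @Modification A M V V (fun x => bhom_id (V x)) _.
Next Obligation.
by move=> V x y a; apply: bhom_tensor_ext => v m; rewrite !bhomE.
Qed.

Program Definition modification_comp V W X
    (T : modification W X) (S : modification V W) : modification V X :=
  @Modification A M V X (fun x => bhom_comp (T x) (S x)) _.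
Next Obligation.
move=> V W X T S x y a; apply: bhom_tensor_ext => v m; rewrite !bhomE.
have := bhom_eqE (pure v m) (mdf_nat S a); rewrite !bhomE => ->.
by have := bhom_eqE (pure (S x v) m) (mdf_nat T a); rewrite !bhomE.
Qed.

Program Definition Lax : category :=
  @Category (lax_transformation A M) (@modification A M) modification_id
    modification_comp _ _ _.
Next Obligation.
move=> V W T; apply: modification_ext => x; apply: bhom_ext => m /=.
by rewrite !bhomE.
Qed.
Next Obligation.
move=> V W T; apply: modification_ext => x; apply: bhom_ext => m /=.
by rewrite !bhomE.
Qed.
Next Obligation.
move=> V W X Y T S R; apply: modification_ext => x; apply: bhom_ext => m /=.
by rewrite !bhomE.
Qed.

End Cat.

Definition Rep (M : pseudofunctor k C) : category := Lax (base_ualg k) M.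

Section PiStar.
Variables (M : pseudofunctor k C) (L : ualgType k) (p : lax_transformation L M).
Variable A : ualgType k.

Program Definition pi_star_ob (N : bimodule A L) : lax_transformation A M :=
  @LaxTransformation A M (fun x => N ⊗ p x)
    (fun x y a => bhom_comp (tensor_map (bhom_id N) (lax_hom p a))
                            (associator N (p x) (ps_hom M a))) _ _.
Next Obligation.
move=> N x; apply: bhom_tensor3_ext => n v m.
by rewrite !bhomE lax_id !bhomE ract_pure.
Qed.
Next Obligation.
move=> N x y z b a; apply: bhom_tensor4_ext => n v m m'.
have := bhom_eqE (pure (pure v m) m') (lax_comp p b a).
by rewrite !bhomE => ->.
Qed.

Program Definition pi_star : cfunctor (Bimod A L) (Lax A M) :=
  @CFunctor (Bimod A L) (Lax A M) pi_star_ob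
    (fun N N' f => @Modification A M (pi_star_ob N) (pi_star_ob N')
                     (fun x => tensor_map f (bhom_id (p x))) _) _ _.
Next Obligation.
move=> N N' f x y a; apply: bhom_tensor3_ext => n v m /=.
by rewrite !bhomE.
Qed.
Next Obligation.
move=> N; apply: modification_ext => x; apply: bhom_tensor_ext => n v /=.
by rewrite !bhomE.
Qed.
Next Obligation.
move=> N N' N'' g f; apply: modification_ext => x; apply: bhom_tensor_ext => n v /=.
by rewrite !bhomE.
Qed.

End PiStar.

(* [L] with the lax transformation [p] from the constant pseudofunctor [L]. *)
Definition is_2limit (M : pseudofunctor k C) (L : ualgType k)
    (p : lax_transformation L M) : Prop :=
  forall A : ualgType k, is_equivalence (pi_star p A).

End LaxTransformations.

Section DirectSum.
Variables (k : comPzRingType) (I : choiceType) (F : I -> lmodType k).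

Record dsum := DSum {
  dfun :> forall i, F i;
  dsum_fin : finite_set [set i | dfun i != 0]
}.

HB.instance Definition _ := gen_eqMixin dsum.
HB.instance Definition _ := gen_choiceMixin dsum.

Lemma dsumP (f g : dsum) : (forall i, f i = g i) -> f = g.
Proof.
case: f g => [f f1] [g g1] /= e.
have {}e : f = g by apply: functional_extensionality_dep.
by subst g; rewrite (Prop_irrelevance f1 g1).
Qed.

Fact dsum0_fin : finite_set [set i | (0 : F i) != 0].
Proof. by apply: (sub_finite_set _ (@finite_set0 I)) => i /=; rewrite eqxx. Qed.
Fact dsumD_fin (f g : dsum) : finite_set [set i | f i + g i != 0].
Proof.
have : finite_set ([set i | f i != 0] `|` [set i | g i != 0])%classic.
  by rewrite finite_setU; split; apply: dsum_fin.
apply: sub_finite_set => i /= h; case: (eqVneq (f i) 0) => [fi|]; last by left.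
by right; move: h; rewrite fi add0r.
Qed.
Fact dsumZ_fin c (f : dsum) : finite_set [set i | c *: f i != 0].
Proof.
apply: sub_finite_set (dsum_fin f) => i /=.
by apply: contraNneq => ->; rewrite scaler0.
Qed.
Fact dsumN_fin (f : dsum) : finite_set [set i | - f i != 0].
Proof. by apply: sub_finite_set (dsum_fin f) => i /=; rewrite oppr_eq0. Qed.

Let dadd f g := DSum (dsumD_fin f g).
Let dopp f := DSum (dsumN_fin f).
Let dscale c f := DSum (dsumZ_fin c f).

Fact dsum_addA : associative dadd.
Proof. by move=> f g h; apply: dsumP => i /=; rewrite addrA. Qed.
Fact dsum_addC : commutative dadd.
Proof. by move=> f g; apply: dsumP => i /=; rewrite addrC. Qed.
Fact dsum_add0 : left_id (DSum dsum0_fin) dadd.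
Proof. by move=> f; apply: dsumP => i /=; rewrite add0r. Qed.
Fact dsum_addN : left_inverse (DSum dsum0_fin) dopp dadd.
Proof. by move=> f; apply: dsumP => i /=; rewrite addNr. Qed.
HB.instance Definition _ :=
  GRing.isZmodule.Build dsum dsum_addA dsum_addC dsum_add0 dsum_addN.

Fact dsum_scaleA a b f : dscale a (dscale b f) = dscale (a * b) f.
Proof. by apply: dsumP => i /=; rewrite scalerA. Qed.
Fact dsum_scale1 : left_id 1 dscale.
Proof. by move=> f; apply: dsumP => i /=; rewrite scale1r. Qed.
Fact dsum_scaleDr : right_distributive dscale +%R.
Proof. by move=> c f g; apply: dsumP => i /=; rewrite scalerDr. Qed.
Fact dsum_scaleDl f : {morph dscale^~ f : a b / a + b}.
Proof. by move=> a b; apply: dsumP => i /=; rewrite scalerDl. Qed.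
HB.instance Definition _ := GRing.Zmodule_isLmodule.Build k dsum
  dsum_scaleA dsum_scale1 dsum_scaleDr dsum_scaleDl.

Lemma dsumDE (f g : dsum) i : (f + g) i = f i + g i. Proof. by []. Qed.
Lemma dsumZE c (f : dsum) i : (c *: f) i = c *: f i. Proof. by []. Qed.
Lemma dsum0E i : (0 : dsum) i = 0. Proof. by []. Qed.
Lemma dsum_sumE T (r : seq T) (f : T -> dsum) i :
  (\sum_(t <- r) f t) i = \sum_(t <- r) f t i.
Proof. exact: (big_morph (fun f : dsum => f i)). Qed.

Definition dinj_fun i (m : F i) j : F j :=
  if i =P j is ReflectT e then ecast i (F i) e m else 0.
Fact dinj_fin i (m : F i) : finite_set [set j | dinj_fun m j != 0].
Proof.
apply: (sub_finite_set _ (finite_set1 i)) => j /=; rewrite /dinj_fun.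
by case: eqP => [e _|_]; [exact: esym e | rewrite eqxx].
Qed.
Definition dinj i (m : F i) : dsum := DSum (dinj_fin m).

Lemma dinjE i (m : F i) : dinj m i = m.
Proof.
rewrite /= /dinj_fun; case: eqP => // e.
by rewrite (Prop_irrelevance e erefl).
Qed.
Lemma dinj_neq i (m : F i) j : i != j -> dinj m j = 0.
Proof. by rewrite /= /dinj_fun; case: eqP. Qed.

Lemma dinj_linear i : linear (@dinj i).
Proof.
move=> c m n; apply: dsumP => j; rewrite dsumDE dsumZE.
case: (eqVneq i j) => [e|ij]; first by case: j / e; rewrite !dinjE.
by rewrite !dinj_neq // scaler0 addr0.
Qed.
HB.instance Definition _ i :=
  GRing.isLinear.Build k (F i) dsum *:%R (@dinj i) (@dinj_linear i).

Lemma dsum_support (f g : dsum) : exists s : seq I, uniq s /\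
  (forall i, i \notin s -> f i = 0 /\ g i = 0).
Proof.
have := dsum_fin f; have := dsum_fin g.
move=> /finite_seqP [s hs] /finite_seqP [t ht].
exists (undup (s ++ t)); split; first exact: undup_uniq.
move=> i; rewrite mem_undup mem_cat negb_or => /andP [i_s i_t]; split.
  apply/eqP; apply: contraNT i_t => h.
  by have : [set` t]%classic i by rewrite -ht.
apply/eqP; apply: contraNT i_s => h.
by have : [set` s]%classic i by rewrite -hs.
Qed.

Lemma dsum_decomp (f : dsum) (s : seq I) :
  uniq s -> (forall i, i \notin s -> f i = 0) -> f = \sum_(i <- s) dinj (f i).
Proof.
move=> us hs; apply: dsumP => j; rewrite dsum_sumE.
case: (boolP (j \in s)) => js.
  rewrite (bigD1_seq j) //= -/(dinj _ _) [dinj_fun _ _]dinjE big1 ?addr0 //.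
  by move=> i ij; apply: dinj_neq.
rewrite hs // big_seq big1 // => i i_s; apply: dinj_neq.
by apply: contraNneq js => <-.
Qed.

Lemma dsum_ind (Q : dsum -> Prop) :
  Q 0 -> (forall i (m : F i) f, Q f -> Q (dinj m + f)) -> forall f, Q f.
Proof.
move=> Q0 QD f; have [s [us hs]] := dsum_support f f.
rewrite (dsum_decomp us (fun i h => proj1 (hs i h))).
by elim: s {us hs} => [|i s IH]; rewrite ?big_nil ?big_cons //; apply: QD.
Qed.

Definition dlift (V : lmodType k) (h : forall i, F i -> V) (f : dsum) : V :=
  \sum_(i \in [set: I]) h i (f i).

Section Lift.
Variables (V : lmodType k) (h : forall i, F i -> V).
Hypothesis hlin : forall i, linear (@h i).

Let h0 i : @h i 0 = 0.
Proof.
have := hlin 1 (0 : F i) 0; rewrite !scale1r addr0 => e.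
by apply: (addrI (@h i 0)); rewrite -e addr0.
Qed.

Let dlift_seq (f : dsum) (s : seq I) : uniq s ->
  (forall i, i \notin s -> f i = 0) -> dlift h f = \sum_(i <- s) @h i (f i).
Proof.
move=> us hs; rewrite (fsbig_seq _ _ us); apply/esym/fsbig_widen => // i [_ /= /negP i_s].
by rewrite hs.
Qed.

Lemma dlift_linear : linear (dlift h).
Proof.
move=> c f g; have [s [us hs]] := dsum_support f g.
rewrite !(dlift_seq us) => [|i /hs []|i /hs []|i /hs [fi gi]] //; last first.
  by rewrite dsumDE dsumZE fi gi scaler0 addr0.
rewrite scaler_sumr -big_split; apply: eq_bigr => i _ /=.
exact: hlin.
Qed.

Lemma dlift_dinj i (m : F i) : dlift h (dinj m) = @h i m.
Proof.
rewrite (@dlift_seq _ [:: i]) // => [|j].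
  by rewrite big_seq1 dinjE.
by rewrite inE eq_sym => /dinj_neq.
Qed.

End Lift.

End DirectSum.

Record fc_mor (C : finob_category) := FcMor {
  fc_dom : C;
  fc_cod : C;
  fc_arr :> fc_hom fc_dom fc_cod
}.
HB.instance Definition _ C := gen_eqMixin (fc_mor C).
HB.instance Definition _ C := gen_choiceMixin (fc_mor C).

Section CategoryAlgebra.
Variables (k : comPzRingType) (C : finob_category) (M : pseudofunctor k C).

Let comp_mod (g : fc_mor C) : lmodType k := ps_hom M g.

Definition mcat_sum := dsum comp_mod.
HB.instance Definition _ := GRing.Lmodule.on mcat_sum.

Definition homog x y (a : fc_hom x y) (m : ps_hom M a) : mcat_sum :=
  @dinj k _ comp_mod (FcMor a) m.

(* The product composes from left to right, a before b, and is 0 unless a and b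
   are composable in that order. *)
Definition homog_mul x y y' z (a : fc_hom x y) (b : fc_hom y' z)
    (m : ps_hom M a) (n : ps_hom M b) : mcat_sum :=
  match y =P y' with
  | ReflectT e =>
      (let: erefl in _ = t := e
         return forall b : fc_hom t z, ps_hom M b -> mcat_sum in
       fun b n => homog (ps_comp M b a (pure m n))) b n
  | ReflectF _ => 0
  end.

Definition mcat_mul (f g : mcat_sum) : mcat_sum :=
  dlift (fun i (m : comp_mod i) =>
    dlift (fun j (n : comp_mod j) => @homog_mul _ _ _ _ i j m n) g) f.

(* The element u of M(x) = M(1_x), in degree 1_x. *)
Definition homog_id x (u : M x) : mcat_sum :=
  homog (bhom_of_eq (esym (ps_id M x)) (u : regular_bimodule (M x))).

Definition mcat_one : mcat_sum := \sum_x homog_id (1 : M x).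

Lemma homog_linear x y (a : fc_hom x y) : linear (@homog x y a).
Proof. exact: (@dinj_linear k _ comp_mod (FcMor a)). Qed.
HB.instance Definition _ x y (a : fc_hom x y) :=
  GRing.isLinear.Build k (ps_hom M a) mcat_sum *:%R (@homog x y a)
    (@homog_linear x y a).

Lemma homog_mulE x y z (a : fc_hom x y) (b : fc_hom y z) m n :
  @homog_mul x y y z a b m n = homog (ps_comp M b a (pure m n)).
Proof.
rewrite /homog_mul; case: eqP => // e.
by rewrite (Prop_irrelevance e erefl).
Qed.

Lemma homog_mul_neq x y y' z (a : fc_hom x y) (b : fc_hom y' z) m n :
  y != y' -> @homog_mul x y y' z a b m n = 0.
Proof. by rewrite /homog_mul; case: eqP. Qed.

Let homog_mul_linl x y y' z (a : fc_hom x y) (b : fc_hom y' z) n :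
  linear (fun m => @homog_mul x y y' z a b m n).
Proof.
move=> c m m'; case: (eqVneq y y') => [e|ne].
  by case: y' / e b n => b n; rewrite !homog_mulE pureDl pureZl !linearP.
by rewrite !homog_mul_neq // scaler0 addr0.
Qed.

Let homog_mul_linr x y y' z (a : fc_hom x y) (b : fc_hom y' z) m :
  linear (fun n => @homog_mul x y y' z a b m n).
Proof.
move=> c n n'; case: (eqVneq y y') => [e|ne].
  by case: y' / e b n n' => b n n'; rewrite !homog_mulE pureDr pureZr !linearP.
by rewrite !homog_mul_neq // scaler0 addr0.
Qed.

Let mul_inner_lin g (i : fc_mor C) :
  linear (fun m : comp_mod i =>
    dlift (fun j (n : comp_mod j) => @homog_mul _ _ _ _ i j m n) g).
Proof.
move=> c m m'; move: g.
have L m0 : linear (dlift (fun j (n : comp_mod j) => @homog_mul _ _ _ _ i j m0 n)).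
  by apply: dlift_linear => j; apply: homog_mul_linr.
have D m0 g h : dlift (fun j (n : comp_mod j) => @homog_mul _ _ _ _ i j m0 n) (g + h)
  = dlift (fun j (n : comp_mod j) => @homog_mul _ _ _ _ i j m0 n) g
  + dlift (fun j (n : comp_mod j) => @homog_mul _ _ _ _ i j m0 n) h.
  by have := L m0 1 g h; rewrite !scale1r.
have Z m0 : dlift (fun j (n : comp_mod j) => @homog_mul _ _ _ _ i j m0 n) 0 = 0.
  by apply: (addrI (dlift (fun j (n : comp_mod j) => @homog_mul _ _ _ _ i j m0 n) 0));
     rewrite -D !addr0.
apply: dsum_ind => [|j n g IH]; first by rewrite !Z scaler0 addr0.
rewrite !D IH scalerDr addrACA; congr (_ + _).
rewrite !dlift_dinj; try by move=> j'; apply: homog_mul_linr.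
exact: homog_mul_linl.
Qed.

Let mulP g : linear (mcat_mul^~ g).
Proof. by apply: dlift_linear => i; apply: mul_inner_lin. Qed.

Let mulD g h f : mcat_mul (g + h) f = mcat_mul g f + mcat_mul h f.
Proof. by have := mulP f 1 g h; rewrite !scale1r. Qed.

Let mul0 g : mcat_mul 0 g = 0.
Proof. by apply: (addrI (mcat_mul 0 g)); rewrite -mulD !addr0. Qed.

Let mul_homogl x y (a : fc_hom x y) (m : ps_hom M a) g :
  mcat_mul (homog m) g =
  dlift (fun j (n : comp_mod j) => @homog_mul _ _ _ _ a j m n) g.
Proof.
by rewrite /mcat_mul /homog (dlift_dinj (fun i => mul_inner_lin g (i := i))).
Qed.

Let mul_homog x y y' z (a : fc_hom x y) (b : fc_hom y' z)
    (m : ps_hom M a) (n : ps_hom M b) :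
  mcat_mul (homog m) (homog n) = homog_mul m n.
Proof.
by rewrite mul_homogl /homog dlift_dinj // => j; apply: homog_mul_linr.
Qed.

Lemma mcat_ind (Q : mcat_sum -> Prop) :
  Q 0 -> (forall x y (a : fc_hom x y) (m : ps_hom M a) f, Q f -> Q (homog m + f)) ->
  forall f, Q f.
Proof. by move=> Q0 QD; apply: dsum_ind => // -[x y a] m f; apply: QD. Qed.

Let mulr f : linear (mcat_mul f).
Proof.
move: f; apply: mcat_ind => [|x y a m f IH] c g h.
  by rewrite !mul0 scaler0 addr0.
rewrite !mulD IH scalerDr addrACA; congr (_ + _).
rewrite !mul_homogl; apply: (dlift_linear (fun j => homog_mul_linr m)) => //.
Qed.

Let mulrD f g h : mcat_mul f (g + h) = mcat_mul f g + mcat_mul f h.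
Proof. by have := mulr f 1 g h; rewrite !scale1r. Qed.

Let mulr0' f : mcat_mul f 0 = 0.
Proof. by apply: (addrI (mcat_mul f 0)); rewrite -mulrD !addr0. Qed.

Lemma homog_cast x y (a b : fc_hom x y) (e : a = b) (m : ps_hom M a) :
  homog (bhom_of_eq (congr1 (@ps_hom k C M x y) e) m) = homog m.
Proof. by case: b / e. Qed.

Lemma homog_id_mul x y (a : fc_hom x y) (u : M x) (m : ps_hom M a) :
  mcat_mul (homog_id u) (homog m) = homog (lact u m).
Proof.
rewrite /homog_id mul_homog homog_mulE -(homog_cast (fc_compf1 a)).
congr homog.
have := bhom_eqE (pure (bhom_of_eq (esym (ps_id M x)) (u : regular_bimodule (M x))) m)
  (ps_compf1 M a).
by rewrite !bhomE bhom_of_eqK.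
Qed.

Lemma homog_mul_id x y (a : fc_hom x y) (m : ps_hom M a) (u : M y) :
  mcat_mul (homog m) (homog_id u) = homog (ract m u).
Proof.
rewrite /homog_id mul_homog homog_mulE -(homog_cast (fc_comp1f a)).
congr homog.
have := bhom_eqE (pure m (bhom_of_eq (esym (ps_id M y)) (u : regular_bimodule (M y))))
  (ps_comp1f M a).
by rewrite !bhomE bhom_of_eqK.
Qed.

Fact mcat_mulA : associative mcat_mul.
Proof.
move=> f g h; move: f; apply: mcat_ind => [|x y a m f IH].
  by rewrite !mul0.
rewrite !mulD IH; congr (_ + _) => {f IH}.
move: g; apply: mcat_ind => [|y' z b n g IH]; first by rewrite !(mul0, mulr0').
rewrite !(mulD, mulrD) IH; congr (_ + _) => {g IH}.
move: h; apply: mcat_ind => [|z' t c p h IH]; first by rewrite !(mul0, mulr0').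
rewrite !mulrD IH; congr (_ + _) => {h IH}.
case: (eqVneq y y') => [e|ne]; last first.
  rewrite (mul_homog m) homog_mul_neq // mul0 mul_homog.
  case: (eqVneq z z') => [e|ne']; last by rewrite homog_mul_neq ?mulr0'.
  case: z' / e c p => c p.
  by rewrite homog_mulE mul_homog homog_mul_neq.
case: y' / e b n => b n.
case: (eqVneq z z') => [e|ne]; last first.
  rewrite (mul_homog n) homog_mul_neq // mulr0' (mul_homog m) homog_mulE.
  by rewrite mul_homog homog_mul_neq.
case: z' / e c p => c p.
rewrite !(mul_homog, homog_mulE).
have := bhom_eqE (pure (pure m n) p) (ps_compA M c b a).
rewrite !bhomE => ->.
by rewrite homog_cast.
Qed.

Fact mcat_mul1l : left_id mcat_one mcat_mul.
Proof.
apply: mcat_ind => [|x y a m f IH]; first exact: mulr0'.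
rewrite mulrD IH; congr (_ + _).
rewrite /mcat_one (big_morph (mcat_mul^~ (homog m)) (fun g h => mulD g h _) (mul0 _)).
rewrite (bigD1 x) //= homog_id_mul lact1 big1 ?addr0 // => x' ne.
by rewrite /homog_id mul_homog homog_mul_neq.
Qed.

Fact mcat_mul1r : right_id mcat_one mcat_mul.
Proof.
apply: mcat_ind => [|x y a m f IH]; first exact: mul0.
rewrite mulD IH; congr (_ + _).
rewrite /mcat_one (big_morph (mcat_mul (homog m)) (mulrD _) (mulr0' _)).
rewrite (bigD1 y) //= homog_mul_id ract1 big1 ?addr0 // => y' ne.
by rewrite /homog_id mul_homog homog_mul_neq // eq_sym.
Qed.

Lemma mcat_axioms : is_ualgebra mcat_one mcat_mul.
Proof.
split.
- exact: mcat_mulA.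
- exact: mcat_mul1l.
- exact: mcat_mul1r.
- by move=> f g h; rewrite mulD.
- by move=> f g h; rewrite mulrD.
- by move=> c f g; have := mulP g c f 0; rewrite mul0 !addr0.
- by move=> c f g; have := mulr f c g 0; rewrite mulr0' !addr0.
Qed.

Definition mcat_alg : ualgType k := UAlgType mcat_axioms.

Lemma homogM x y z (a : fc_hom x y) (b : fc_hom y z)
    (m : ps_hom M a) (n : ps_hom M b) :
  (homog m : mcat_alg) * (homog n : mcat_alg) = homog (ps_comp M b a (pure m n)).
Proof. by rewrite [LHS]mul_homog homog_mulE. Qed.

Lemma homogM_neq x y y' z (a : fc_hom x y) (b : fc_hom y' z)
    (m : ps_hom M a) (n : ps_hom M b) : y != y' ->
  (homog m : mcat_alg) * (homog n : mcat_alg) = 0.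
Proof. by move=> ne; rewrite [LHS]mul_homog homog_mul_neq. Qed.

End CategoryAlgebra.

Section CanonicalLax.
Variables (k : comPzRingType) (C : finob_category) (M : pseudofunctor k C).

Let L : ualgType k := mcat_alg M.

(* The left ideal generated by 1_{M(x)}, seen in degree 1_x. *)
Definition left_ideal_pred (x : C) : {pred mcat_alg M} :=
  fun f => `[< exists g : mcat_alg M, f = g * (homog_id (1 : M x) : mcat_alg M) >].

Record left_ideal (x : C) := LeftIdeal {
  li_val : mcat_alg M;
  li_valP : li_val \in left_ideal_pred x
}.

HB.instance Definition _ x := [isSub for @li_val x].
HB.instance Definition _ x := [Choice of left_ideal x by <:].

Fact left_ideal_closed x : subsemimod_closed (left_ideal_pred x).
Proof.
split; first split.
- by apply/asboolP; exists 0; rewrite mul0r.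
- move=> f g /asboolP [f' ->] /asboolP [g' ->]; apply/asboolP.
  by exists (f' + g'); rewrite mulrDl.
- move=> c f /asboolP [f' ->]; apply/asboolP.
  by exists (c *: f'); rewrite uscalerAl.
Qed.

HB.instance Definition _ x :=
  GRing.SubChoice_isSubLmodule.Build k (mcat_alg M) (left_ideal_pred x)
    (left_ideal x) (left_ideal_closed x).

Let hom x y (a : fc_hom x y) (m : ps_hom M a) : L := homog m.
Let hid x (u : M x) : L := homog_id u.

Let homD x y (a : fc_hom x y) (m n : ps_hom M a) : hom (m + n) = hom m + hom n.
Proof. exact: linearD. Qed.
Let homZ x y (a : fc_hom x y) c (m : ps_hom M a) : hom (c *: m) = c *: hom m.
Proof. exact: linearZ. Qed.
Let hidD x (u v : M x) : hid (u + v) = hid u + hid v.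
Proof. by rewrite /hid /homog_id !linearD. Qed.
Let hidZ x c (u : M x) : hid (c *: u) = c *: hid u.
Proof. by rewrite /hid /homog_id !linearZ. Qed.
Let hid_hom x y (a : fc_hom x y) (u : M x) (m : ps_hom M a) :
  hid u * hom m = hom (lact u m).
Proof. exact: homog_id_mul. Qed.
Let hom_hid x y (a : fc_hom x y) (u : M y) (m : ps_hom M a) :
  hom m * hid u = hom (ract m u).
Proof. exact: homog_mul_id. Qed.
Let hidM x (u v : M x) : hid u * hid v = hid (u * v).
Proof. by rewrite [LHS]homog_id_mul -bhom_lact. Qed.
Let hid1r x (f : left_ideal x) : li_val f * hid (1 : M x) = li_val f.
Proof. by case: f => f /asboolP [g /= ->]; rewrite -mulrA hidM mulr1. Qed.

Fact li_lact_subproof x (g : L) (f : left_ideal x) :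
  g * li_val f \in left_ideal_pred x.
Proof. by apply/asboolP; exists (g * li_val f); rewrite -mulrA hid1r. Qed.
Fact li_ract_subproof x (f : left_ideal x) (u : M x) :
  li_val f * hid u \in left_ideal_pred x.
Proof. by apply/asboolP; exists (li_val f * hid u); rewrite -mulrA hidM mulr1. Qed.
Fact li_homog_subproof x y (a : fc_hom x y) (f : left_ideal x) (m : ps_hom M a) :
  li_val f * hom m \in left_ideal_pred y.
Proof.
by apply/asboolP; exists (li_val f * hom m); rewrite -mulrA hom_hid ract1.
Qed.

Definition li_lact x (g : mcat_alg M) (f : left_ideal x) : left_ideal x :=
  LeftIdeal (li_lact_subproof g f).
Definition li_ract x (f : left_ideal x) (u : M x) : left_ideal x :=
  LeftIdeal (li_ract_subproof f u).
Definition li_homog x y (a : fc_hom x y) (f : left_ideal x) (m : ps_hom M a) :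
  left_ideal y := LeftIdeal (li_homog_subproof f m).

Definition can_lax_ob (x : C) : bimodule (mcat_alg M) (M x).
Proof.
refine (@Bimodule k (mcat_alg M) (M x) (left_ideal x) (@li_lact x) (@li_ract x)
  _ _ _ _ _ _ _ _ _ _ _ _ _) => *; apply: val_inj => /=.
- by rewrite mul1r.
- by rewrite mulrA.
- by rewrite mulrDl.
- by rewrite mulrDr.
- by rewrite uscalerAl.
- by rewrite uscalerAr.
- by rewrite hid1r.
- by rewrite -mulrA hidM.
- by rewrite mulrDl.
- by rewrite hidD mulrDr.
- by rewrite uscalerAl.
- by rewrite hidZ uscalerAr.
- by rewrite mulrA.
Defined.

Fact can_lax_hom_subproof x y (a : fc_hom x y) :
  @bilinear_balanced _ _ _ _ (can_lax_ob x) (ps_hom M a) (can_lax_ob y)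
    (fun f m => li_homog f m).
Proof.
split; first split.
- by move=> f g m; apply: val_inj; rewrite /= mulrDl.
- by move=> f m n; apply: val_inj; rewrite /= homD mulrDr.
- by move=> f u m; apply: val_inj; rewrite /= -mulrA hid_hom.
- by move=> g f m; apply: val_inj; rewrite /= mulrA.
- by move=> f m u; apply: val_inj; rewrite /= -mulrA hom_hid.
Qed.

Definition can_lax_hom x y (a : fc_hom x y) :
  bimod_hom (can_lax_ob x ⊗ ps_hom M a) (can_lax_ob y) :=
  tensor_hom (can_lax_hom_subproof a).

Lemma can_lax_hom_pure x y (a : fc_hom x y) (f : can_lax_ob x) (m : ps_hom M a) :
  li_val (can_lax_hom a (pure f m)) = li_val f * (homog m : mcat_alg M).
Proof. by rewrite /can_lax_hom tensor_hom_pure. Qed.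

Program Definition can_lax : lax_transformation (mcat_alg M) M :=
  @LaxTransformation k C (mcat_alg M) M can_lax_ob can_lax_hom _ _.
Next Obligation.
move=> x; apply: bhom_tensor_ext => f m; apply: val_inj.
rewrite [LHS]can_lax_hom_pure !bhomE /=; congr (_ * _).
by rewrite /hid /homog_id bhom_of_eqVK.
Qed.
Next Obligation.
move=> x y z b a; apply: bhom_tensor3_ext => f m n; apply: val_inj.
rewrite !bhomE [LHS]can_lax_hom_pure [RHS]can_lax_hom_pure can_lax_hom_pure.
by rewrite -mulrA homogM.
Qed.

End CanonicalLax.

(* The comodulated category algebra W[C] is built on C^op: a morphism y -> x of
   [fc_op C] is a morphism a : x -> y of C, and W(a) is a W(y)-W(x)-bimodule. *)
Section Comodulated.
Variables (k : comPzRingType) (C : finob_category) (W : comodulation k C).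

Definition comcat_sum := @mcat_sum k (fc_op C) W.
Definition comcat_one : comcat_sum := @mcat_one k (fc_op C) W.
Definition comcat_mul : comcat_sum -> comcat_sum -> comcat_sum :=
  @mcat_mul k (fc_op C) W.
Definition comcat_alg : ualgType k := @mcat_alg k (fc_op C) W.
Definition co_can_lax : lax_transformation comcat_alg W :=
  @can_lax k (fc_op C) W.

Definition cohomog (x y : C) (a : fc_hom x y)
    (w : @ps_hom k (fc_op C) W y x a) : comcat_alg := homog w.

(* The structure isomorphism W(b) ⊗ W(a) -> W(ba) for a : x -> y, b : y -> z. *)
Definition co_comp (x y z : C) (a : fc_hom x y) (b : fc_hom y z) :
  bimod_hom (@ps_hom k (fc_op C) W z y b ⊗ @ps_hom k (fc_op C) W y x a)
            (@ps_hom k (fc_op C) W z x (fc_comp b a)) :=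
  @ps_comp k (fc_op C) W z y x a b.

Lemma cohomogM (x y z : C) (a : fc_hom x y) (b : fc_hom y z)
    (wb : @ps_hom k (fc_op C) W z y b) (wa : @ps_hom k (fc_op C) W y x a) :
  cohomog wb * cohomog wa = cohomog (co_comp a b (pure wb wa)).
Proof. exact: (@homogM k (fc_op C)). Qed.

Lemma cohomogM_neq (x y y' z : C) (a : fc_hom x y) (b : fc_hom y' z)
    (wb : @ps_hom k (fc_op C) W z y' b) (wa : @ps_hom k (fc_op C) W y x a) :
  y' != y -> cohomog wb * cohomog wa = 0.
Proof. exact: (@homogM_neq k (fc_op C)). Qed.

End Comodulated.

(* Main.v *)
Require Import Defs.
From HB Require Import structures.
From mathcomp Require Import all_boot all_order all_algebra.
From mathcomp Require Import boolp classical_sets cardinality.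

Set Implicit Arguments.
Unset Strict Implicit.
Unset Printing Implicit Defensive.

(** Write L for the category algebra of M and 1_x for the unit of M(x), placed in
    degree id_x.  These elements are orthogonal idempotents of L with sum 1, because
    C has finitely many objects.  A right L-module N therefore splits as the direct
    sum of the N 1_x, and a homogeneous element of degree a : x -> y acts on it as a
    map N 1_x -> N 1_y.  Associativity of the L-action is exactly the coherence of
    these maps with the composition of M, so N carries the same information as the
    family (N 1_x), which is a lax transformation to M; a left action of A passes
    through this unchanged.  As N ⊗ L 1_x is N 1_x, this family is the image of N
    under pi_*.

    The quasi-inverse of pi_* is thus the functor [lax_sum_functor], sending a lax
    transformation V to the direct sum of the V(x), on which a homogeneous m of
    degree a : x -> y acts by v |-> V(a)(v_x ⊗ m), placed in summand y.  The two
    natural isomorphisms are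
      - [counit] : (sum of the V(y)) ⊗ L 1_x -> V(x), v ⊗ f |-> (v f)_x, with inverse
        v |-> v ⊗ 1_x, v being placed in summand x;
      - [assemble] : sum of the N ⊗ L 1_x -> N, n ⊗ f |-> n f, with inverse
        n |-> (n ⊗ 1_x)_x.
    That each is inverse to its partner rests on f = f 1_x for f in L 1_x, where f can
    be moved across the tensor product ([lact_ideal_gen]), and, for [assemble], on the
    orthogonality of the 1_x ([pure_ideal_act_neq]).

    A right L-module is a k-L-bimodule in a unique way, c in k acting as c 1_L
    ([rmod_to_bimod_equivalence]); composed with the case A = k this gives the
    equivalence between modules and representations.  The contravariant half is the
    covariant one for the opposite category. *)

Import GRing.Theory.
Local Open Scope ring_scope.

#[local] Obligation Tactic := idtac.

(** * Composition of equivalences *)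

Lemma is_cat_iso_comp (X : category) (x y z : X) (g : cat_hom y z) (f : cat_hom x y) :
  is_cat_iso g -> is_cat_iso f -> is_cat_iso (cat_comp g f).
Proof.
move=> [g' [g'g gg']] [f' [f'f ff']]; exists (cat_comp f' g'); split.
  by rewrite cat_compA -(cat_compA f') g'g cat_compf1.
by rewrite cat_compA -(cat_compA g) ff' cat_compf1.
Qed.

Lemma is_cat_iso_fun (X Y : category) (F : cfunctor X Y) (x y : X) (f : cat_hom x y) :
  is_cat_iso f -> is_cat_iso (fun_hom F f).
Proof.
move=> [g [gf fg]]; exists (fun_hom F g).
by rewrite -!fun_comp gf fg !fun_id.
Qed.

Lemma is_equivalence_comp (X Y Z : category) (F : cfunctor X Y) (G : cfunctor Y Z) :
  is_equivalence F -> is_equivalence G -> is_equivalence (cfunctor_comp G F).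
Proof.
move=> [F' [[s [s_iso s_nat]] [t [t_iso t_nat]]]].
move=> [G' [[u [u_iso u_nat]] [w [w_iso w_nat]]]].
exists (cfunctor_comp F' G'); split.
- exists (fun x => cat_comp (s x) (fun_hom F' (u (F x)))); split=> [x|x y f].
    by apply: is_cat_iso_comp; [exact: s_iso | exact: (is_cat_iso_fun F' (u_iso (F x)))].
  rewrite /= -cat_compA -fun_comp.
  have /= -> := u_nat _ _ (fun_hom F f).
  by rewrite fun_comp !cat_compA; have /= -> := s_nat _ _ f.
- exists (fun z => cat_comp (w z) (fun_hom G (t (G' z)))); split=> [z|x y f].
    by apply: is_cat_iso_comp; [exact: w_iso | exact: (is_cat_iso_fun G (t_iso (G' z)))].
  rewrite /= -cat_compA -fun_comp.
  have /= -> := t_nat _ _ (fun_hom G' f).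
  by rewrite fun_comp !cat_compA; have /= -> := w_nat _ _ f.
Qed.

(** * Recognizing isomorphisms *)

Section Isomorphisms.
Variable k : comPzRingType.

Lemma pure0l (A B D : ualgType k) (M : bimodule A B) (N : bimodule B D) (n : N) :
  pure (0 : M) n = 0.
Proof. by rewrite -(scale0r (0 : M)) pureZl !scale0r. Qed.

Lemma ractr0 (A B : ualgType k) (M : bimodule A B) (m : M) : ract m 0 = 0.
Proof. by rewrite -(scale0r (0 : B)) ractZr scale0r. Qed.

(** Bijectivity suffices: the inverse of a map preserves whatever the map does. *)
Lemma bimod_inverse (A B : ualgType k) (M N : bimodule A B) (f : bimod_hom M N)
    (g : N -> M) :
  cancel f g -> cancel g f -> {h : bimod_hom N M | h =1 g}.
Proof.
move=> fK gK.
have glin : linear g.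
  by move=> c u v; apply: (can_inj fK); rewrite gK linearP /= !gK.
have gl a n : g (lact a n) = lact a (g n).
  by apply: (can_inj fK); rewrite gK bhom_lact gK.
have gr n b : g (ract n b) = ract (g n) b.
  by apply: (can_inj fK); rewrite gK bhom_ract gK.
by exists (BimodHom glin gl gr).
Qed.

Lemma bimod_cat_iso (A B : ualgType k) (M N : bimodule A B) (f : bimod_hom M N)
    (g : N -> M) :
  cancel f g -> cancel g f -> is_cat_iso (f : @cat_hom (Bimod A B) M N).
Proof.
move=> fK gK; have [h hE] := bimod_inverse fK gK; exists h.
by split; apply: bhom_ext => m; rewrite /= !bhomE hE ?fK ?gK.
Qed.

(** The pointwise inverses satisfy the naturality squares automatically, so a
    modification is invertible as soon as each of its components is bijective. *)
Lemma modification_cat_iso (C : finob_category) (A : ualgType k)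
    (M : pseudofunctor k C) (V W : lax_transformation A M)
    (T : modification V W) (g : forall x, W x -> V x) :
  (forall x, cancel (T x) (@g x)) -> (forall x, cancel (@g x) (T x)) ->
  is_cat_iso (T : @cat_hom (Lax A M) V W).
Proof.
move=> TK gK; pose h x := sval (bimod_inverse (TK x) (gK x)).
have hE x : h x =1 @g x by rewrite /h; case: bimod_inverse.
have h_nat x y (a : fc_hom x y) : bhom_comp (h y) (lax_hom W a) =
    bhom_comp (lax_hom V a) (tensor_map (h x) (bhom_id (ps_hom M a))).
  apply: bhom_tensor_ext => w m; rewrite !bhomE !hE; apply: (can_inj (TK y)).
  rewrite gK; have := bhom_eqE (pure (g x w) m) (mdf_nat T a).
  by rewrite !bhomE gK.
exists (Modification h_nat); split; apply: modification_ext => x;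
  by apply: bhom_ext => m; rewrite /= !bhomE hE ?TK ?gK.
Qed.

End Isomorphisms.

(** * The direct sum of a lax transformation *)

Section FiniteFamilies.
Variables (k : comPzRingType) (I : finType) (F : I -> lmodType k).

Fact dfam_fin (f : forall i, F i) : finite_set [set i | f i != 0].
Proof. exact: finite_finset. Qed.
Definition dfam (f : forall i, F i) : dsum F := DSum (dfam_fin f).

Lemma dsum_sum_dinj (f : dsum F) : f = \sum_i dinj (f i).
Proof.
apply: dsum_decomp => [|i]; first exact: index_enum_uniq.
by rewrite mem_index_enum.
Qed.

Lemma dfam_dinj (G : I -> lmodType k) (h : forall i, G i -> F i) i (m : G i) :
  (forall j, h j 0 = 0) -> dfam (fun j => h j (dinj m j)) = dinj (h i m).
Proof.
move=> h0; apply: dsumP => j; case: (eqVneq i j) => [e|ne].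
  by case: j / e; rewrite [RHS]dinjE; congr h; exact: dinjE.
by rewrite [RHS]dinj_neq // -[RHS]h0; congr h; exact: dinj_neq.
Qed.

End FiniteFamilies.

Section LaxSum.
Variables (k : comPzRingType) (C : finob_category) (M : pseudofunctor k C).
Variables (A : ualgType k) (V : lax_transformation A M).

Definition lax_sum := dsum (fun x : C => V x : lmodType k).
HB.instance Definition _ := GRing.Lmodule.on lax_sum.

Definition lax_inj (x : C) (v : V x) : lax_sum :=
  @dinj k C (fun x : C => V x : lmodType k) x v.

Definition lax_sum_lact (a : A) (v : lax_sum) : lax_sum :=
  @dfam k C (fun x : C => V x : lmodType k) (fun x => lact a (v x)).

(** An element of degree a : x -> y reads the summand at x and writes into the
    summand at y, so it kills the other summands without a case distinction. *)
Definition lax_sum_ract (v : lax_sum) (f : mcat_alg M) : lax_sum :=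
  dlift (fun (j : fc_mor C) (m : ps_hom M j) =>
    lax_inj (lax_hom V j (pure (v (fc_dom j)) m))) f.

Lemma lax_inj_linear x : linear (@lax_inj x).
Proof. exact: dinj_linear. Qed.
HB.instance Definition _ x :=
  GRing.isLinear.Build k (V x) lax_sum *:%R (@lax_inj x) (@lax_inj_linear x).

Let act_linear (v : lax_sum) (j : fc_mor C) :
  linear (fun m : ps_hom M j => lax_inj (lax_hom V j (pure (v (fc_dom j)) m))).
Proof. by move=> c m n; rewrite pureDr pureZr !linearP. Qed.

Lemma lax_sum_ract_linearr v : linear (lax_sum_ract v).
Proof. exact: (dlift_linear (act_linear v)). Qed.

Lemma lax_sum_ractDr v f g : lax_sum_ract v (f + g) = lax_sum_ract v f + lax_sum_ract v g.
Proof. by have := lax_sum_ract_linearr v 1 f g; rewrite !scale1r. Qed.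

Lemma lax_sum_ract0r v : lax_sum_ract v 0 = 0.
Proof. by apply: (addrI (lax_sum_ract v 0)); rewrite -lax_sum_ractDr !addr0. Qed.

Lemma lax_sum_ract_homog v x y (a : fc_hom x y) (m : ps_hom M a) :
  lax_sum_ract v (homog m) = lax_inj (lax_hom V a (pure (v x) m)).
Proof. exact: (dlift_dinj (act_linear v) (i := FcMor a) m). Qed.

Lemma lax_sum_ract_linearl f : linear (lax_sum_ract^~ f).
Proof.
move: f; apply: mcat_ind => [|x y a m f IH] c v w /=.
  by rewrite !lax_sum_ract0r scaler0 addr0.
rewrite !lax_sum_ractDr IH scalerDr addrACA !lax_sum_ract_homog; congr (_ + _).
by rewrite pureDl pureZl !linearP.
Qed.

Lemma lax_sum_ractDl v w f : lax_sum_ract (v + w) f = lax_sum_ract v f + lax_sum_ract w f.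
Proof. by have := lax_sum_ract_linearl f 1 v w; rewrite !scale1r. Qed.

Lemma lax_sum_ract0l f : lax_sum_ract 0 f = 0.
Proof. by apply: (addrI (lax_sum_ract 0 f)); rewrite -lax_sum_ractDl !addr0. Qed.

(** This is where the normalization V(id_x) enters: elements of M(x) placed in degree
    id_x act through the given action of M(x) on V(x), and 1_x is the projection onto
    the summand V(x). *)
Lemma lax_sum_ract_id v x (u : M x) :
  lax_sum_ract v (homog_id u) = lax_inj (ract (v x) u).
Proof. by rewrite lax_sum_ract_homog lax_id !bhomE bhom_of_eqK. Qed.

(** For composable degrees this is the compatibility of V with composition; for the
    others both sides vanish. *)
Lemma lax_sum_ractM v f g : lax_sum_ract v (f * g) = lax_sum_ract (lax_sum_ract v f) g.
Proof.
move: f; apply: mcat_ind => [|x y a m f IH].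
  by rewrite mul0r lax_sum_ract0r lax_sum_ract0l.
rewrite [_ * _]mulrDl !lax_sum_ractDr lax_sum_ractDl IH; congr (_ + _) => {f IH}.
move: g; apply: mcat_ind => [|y' z b n g IH].
  by rewrite mulr0 !lax_sum_ract0r.
rewrite [_ * _]mulrDr !lax_sum_ractDr IH; congr (_ + _) => {g IH}.
case: (eqVneq y y') => [e|ne]; last first.
  rewrite homogM_neq // lax_sum_ract0r !lax_sum_ract_homog dinj_neq //.
  by rewrite pure0l !linear0.
case: y' / e b n => b n.
rewrite homogM !lax_sum_ract_homog /lax_inj dinjE; congr dinj.
by have := bhom_eqE (pure (pure (v x) m) n) (lax_comp V b a); rewrite !bhomE.
Qed.

Lemma lax_sum_ract1 v : lax_sum_ract v 1 = v.
Proof.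
rewrite [RHS]dsum_sum_dinj [1]/(mcat_one M) /mcat_one.
rewrite (big_morph _ (lax_sum_ractDr v) (lax_sum_ract0r v)).
by apply: eq_bigr => x _; rewrite lax_sum_ract_id ract1.
Qed.

Lemma lax_sum_lact_inj a x (v : V x) : lax_sum_lact a (lax_inj v) = lax_inj (lact a v).
Proof.
exact: (@dfam_dinj k C (fun x => V x : lmodType k) (fun x => V x : lmodType k)
  (fun y => lact a) x v (fun y => lact0 (V y) a)).
Qed.

Lemma lax_sum_lract a v f :
  lax_sum_lact a (lax_sum_ract v f) = lax_sum_ract (lax_sum_lact a v) f.
Proof.
have D u w : lax_sum_lact a (u + w) = lax_sum_lact a u + lax_sum_lact a w.
  by apply: dsumP => x /=; rewrite lactDr.
move: f; apply: mcat_ind => [|x y b m f IH].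
  by rewrite !lax_sum_ract0r; apply: dsumP => x /=; rewrite lact0.
rewrite !lax_sum_ractDr D IH; congr (_ + _).
by rewrite !lax_sum_ract_homog lax_sum_lact_inj -bhom_lact lact_pure.
Qed.

Definition lax_sum_bimodule : bimodule A (mcat_alg M).
Proof.
refine (@Bimodule k A (mcat_alg M) lax_sum lax_sum_lact lax_sum_ract
  _ _ _ _ _ _ lax_sum_ract1 lax_sum_ractM lax_sum_ractDl lax_sum_ractDr _ _ lax_sum_lract).
- by move=> m; apply: dsumP => x /=; rewrite lact1.
- by move=> a b m; apply: dsumP => x /=; rewrite lactM.
- by move=> a b m; apply: dsumP => x /=; rewrite lactDl.
- by move=> a m n; apply: dsumP => x /=; rewrite lactDr.
- by move=> c a m; apply: dsumP => x /=; rewrite lactZl.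
- by move=> c a m; apply: dsumP => x /=; rewrite lactZr.
- by move=> c m b; have := lax_sum_ract_linearl b c m 0; rewrite lax_sum_ract0l !addr0.
- by move=> c m b; have := lax_sum_ract_linearr m c b 0; rewrite lax_sum_ract0r !addr0.
Defined.

End LaxSum.

Section LaxSumFunctor.
Variables (k : comPzRingType) (C : finob_category) (M : pseudofunctor k C).
Variable A : ualgType k.

Section Map.
Variables (V W : lax_transformation A M) (T : modification V W).

Definition lax_sum_map_fun (v : lax_sum V) : lax_sum W :=
  @dfam k C (fun x : C => W x : lmodType k) (fun x => T x (v x)).

Lemma lax_sum_map_inj x (v : V x) : lax_sum_map_fun (lax_inj v) = lax_inj (T x v).
Proof.
exact: (@dfam_dinj k C (fun x => W x : lmodType k) (fun x => V x : lmodType k)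
  (fun y => bhom_fun (T y)) x v (fun y => linear0 (T y))).
Qed.

Lemma lax_sum_map_linear : linear lax_sum_map_fun.
Proof. by move=> c v w; apply: dsumP => x; rewrite /= linearP. Qed.

HB.instance Definition _ := GRing.isLinear.Build k (lax_sum V) (lax_sum W) *:%R
  lax_sum_map_fun lax_sum_map_linear.

Lemma lax_sum_map_ract v f :
  lax_sum_map_fun (lax_sum_ract v f) = lax_sum_ract (lax_sum_map_fun v) f.
Proof.
move: f; apply: mcat_ind => [|x y a m f IH].
  by rewrite !lax_sum_ract0r linear0.
rewrite !lax_sum_ractDr linearD /= IH; congr (_ + _).
rewrite !lax_sum_ract_homog lax_sum_map_inj.
by have := bhom_eqE (pure (v x) m) (mdf_nat T a); rewrite !bhomE => ->.
Qed.

Lemma lax_sum_map_lact a v :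
  lax_sum_map_fun (lax_sum_lact a v) = lax_sum_lact a (lax_sum_map_fun v).
Proof. by apply: dsumP => x /=; rewrite bhom_lact. Qed.

Definition lax_sum_map : bimod_hom (lax_sum_bimodule V) (lax_sum_bimodule W) :=
  @BimodHom k A (mcat_alg M) (lax_sum_bimodule V) (lax_sum_bimodule W)
    lax_sum_map_fun lax_sum_map_linear lax_sum_map_lact lax_sum_map_ract.

End Map.

Program Definition lax_sum_functor : cfunctor (Lax A M) (Bimod A (mcat_alg M)) :=
  @CFunctor (Lax A M) (Bimod A (mcat_alg M)) (@lax_sum_bimodule k C M A)
    (fun V W T => lax_sum_map T) _ _.
Next Obligation.
by move=> V; apply: bhom_ext => v; apply: dsumP => x; rewrite /= !bhomE.
Qed.
Next Obligation.
move=> U V W S T; apply: bhom_ext => v; rewrite /= bhomE.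
by apply: dsumP => x; rewrite /= bhomE.
Qed.

End LaxSumFunctor.

(** * The generators of the left ideals *)

Section IdealGenerators.
Variables (k : comPzRingType) (C : finob_category) (M : pseudofunctor k C).

Fact ideal_gen_subproof (x : C) :
  (homog_id (1 : M x) : mcat_alg M) \in @left_ideal_pred k C M x.
Proof. by apply/asboolP; exists 1; rewrite mul1r. Qed.

Definition ideal_gen (x : C) : can_lax M x := LeftIdeal (ideal_gen_subproof x).

Lemma ideal_mul1 x (f : can_lax M x) :
  li_val f * (homog_id (1 : M x) : mcat_alg M) = li_val f.
Proof. exact: (congr1 (@li_val k C M x) (ract1 f)). Qed.

(** This is how a tensor n ⊗ f in N ⊗ L 1_x is brought to the form (n f) ⊗ 1_x. *)
Lemma lact_ideal_gen x (f : can_lax M x) : lact (li_val f) (ideal_gen x) = f.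
Proof. by apply: val_inj; exact: ideal_mul1. Qed.

End IdealGenerators.

(** * The sum functor is a right inverse *)

Section Counit.
Variables (k : comPzRingType) (C : finob_category) (M : pseudofunctor k C).
Variables (A : ualgType k) (V : lax_transformation A M).

Fact counit_subproof (x : C) :
  @bilinear_balanced _ _ _ _ (lax_sum_bimodule V) (can_lax M x) (V x)
    (fun v f => lax_sum_ract v (li_val f) x).
Proof.
split; first split.
- by move=> v w f; rewrite lax_sum_ractDl.
- by move=> v f g; rewrite lax_sum_ractDr.
- by move=> v g f; rewrite -lax_sum_ractM.
- by move=> a v f; rewrite -lax_sum_lract.
- move=> v f u; rewrite /= lax_sum_ractM lax_sum_ract_id; exact: dinjE.
Qed.

Definition counit_at x : bimod_hom (lax_sum_bimodule V ⊗ can_lax M x) (V x) :=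
  tensor_hom (counit_subproof x).

Lemma counit_at_pure x (v : lax_sum_bimodule V) (f : can_lax M x) :
  counit_at x (pure v f) = lax_sum_ract v (li_val f) x.
Proof. exact: tensor_hom_pure. Qed.

Program Definition counit :
  modification (pi_star_ob (can_lax M) (lax_sum_bimodule V)) V :=
  @Modification k C A M _ _ counit_at _.
Next Obligation.
move=> x y a; apply: bhom_tensor3_ext => v f m.
rewrite /= !bhomE !counit_at_pure can_lax_hom_pure.
rewrite lax_sum_ractM lax_sum_ract_homog; exact: dinjE.
Qed.

Lemma counit_iso :
  is_cat_iso (counit : @cat_hom (Lax A M) _ V).
Proof.
pose g x (v : V x) : lax_sum_bimodule V ⊗ can_lax M x :=
  pure (lax_inj v : lax_sum_bimodule V) (ideal_gen M x).
have gD x : {morph @g x : u v / u + v} by move=> u v; rewrite /g linearD pureDl.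
apply: (@modification_cat_iso _ _ _ _ _ _ counit g) => x.
- apply: tensor_ext => [u v|u v|v f] //; first by rewrite linearD gD.
  rewrite [counit x _]counit_at_pure /g.
  (* Summand x of w is w 1_x, which turns the left side into (v f 1_x) ⊗ 1_x. *)
  rewrite -[X in lax_inj X]ract1 -lax_sum_ract_id -lax_sum_ractM ideal_mul1.
  by rewrite [pure _ _](@pureA _ _ _ _ (lax_sum_bimodule V) _ v) lact_ideal_gen.
- move=> v; rewrite [LHS]counit_at_pure /= lax_sum_ract_id ract1.
  by rewrite /lax_inj !dinjE.
Qed.

End Counit.

(** * The sum functor is a left inverse *)

Section Assembly.
Variables (k : comPzRingType) (C : finob_category) (M : pseudofunctor k C).
Variable A : ualgType k.
Implicit Types N : bimodule A (mcat_alg M).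

Fact ideal_act_balanced N (x : C) :
  @balanced _ _ _ _ N (can_lax M x) N (fun n f => ract n (li_val f)).
Proof.
split.
- by move=> m n f; rewrite ractDl.
- by move=> n f g; rewrite ractDr.
- by move=> n f g; rewrite -ractM.
Qed.

(** This is n ⊗ f |-> n f.  Its image is N 1_x, stable under 1_x L 1_x but in
    general not under L, so on the right a homogeneous element relates the maps
    of two different objects ([ideal_act_homog]). *)
Definition ideal_act N x (t : N ⊗ can_lax M x) : N :=
  tlift (fun (n : N) (f : can_lax M x) => ract n (li_val f)) t.

Lemma ideal_act_pure N x (n : N) (f : can_lax M x) :
  ideal_act (pure n f) = ract n (li_val f).
Proof. exact: (tlift_gen (ideal_act_balanced N x)). Qed.

Lemma ideal_act_linear N x : linear (@ideal_act N x).
Proof.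
apply: (tlift_linear (ideal_act_balanced N x)) => c n f.
by rewrite ractZl.
Qed.
HB.instance Definition _ N x :=
  GRing.isLinear.Build k (N ⊗ can_lax M x) N *:%R (@ideal_act N x)
    (@ideal_act_linear N x).

Lemma ideal_act_lact N x (a : A) (t : N ⊗ can_lax M x) :
  ideal_act (lact a t) = lact a (ideal_act t).
Proof.
move: t; apply: tensor_ext => [s t|s t|n f].
- by rewrite lactDr linearD.
- by rewrite linearD lactDr.
- by rewrite lact_pure !ideal_act_pure lractA.
Qed.

Lemma ideal_act_homog N x y (a : fc_hom x y) (m : ps_hom M a) (t : N ⊗ can_lax M x) :
  ract (ideal_act t) (homog m) =
  ideal_act (lax_hom (pi_star_ob (can_lax M) N) a (pure t m)).
Proof.
move: t; apply: tensor_ext => [s t|s t|n f].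
- by rewrite linearD ractDl.
- by rewrite pureDl !linearD.
- by rewrite /= !bhomE !ideal_act_pure can_lax_hom_pure ractM.
Qed.

(** The image of [ideal_act] is fixed by 1_x, which annihilates from the left every
    element whose degree does not start at x. *)
Lemma ideal_act_homog_neq N x y z (a : fc_hom y z) (m : ps_hom M a)
    (t : N ⊗ can_lax M x) :
  x != y -> ract (ideal_act t) (homog m) = 0.
Proof.
move=> xy; move: t; apply: (@tensor_ext _ _ _ _ _ _ N
  (fun t => ract (ideal_act t) (homog m)) (fun=> 0)) => [s t|s t|n f].
- by rewrite linearD ractDl.
- by rewrite addr0.
- by rewrite ideal_act_pure -(ideal_mul1 f) -ractM -mulrA homogM_neq // mulr0 ractr0.
Qed.

(** This and the next lemma make n |-> (n ⊗ 1_x)_x a left inverse of [assemble]: the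
    1_x are orthogonal, so they separate the summands N ⊗ L 1_x. *)
Lemma pure_ideal_act N x (t : N ⊗ can_lax M x) :
  pure (ideal_act t) (ideal_gen M x) = t.
Proof.
move: t; apply: tensor_ext => [s t|s t|n f] //; first by rewrite linearD pureDl.
by rewrite ideal_act_pure pureA lact_ideal_gen.
Qed.

Lemma pure_ideal_act_neq N x y (t : N ⊗ can_lax M x) :
  x != y -> pure (ideal_act t) (ideal_gen M y) = 0.
Proof.
move=> xy; have e : lact (homog_id (1 : M y) : mcat_alg M) (ideal_gen M y) = ideal_gen M y.
  exact: (lact_ideal_gen (ideal_gen M y)).
by rewrite -e -pureA ideal_act_homog_neq // pure0l.
Qed.

Section Component.
Variable N : bimodule A (mcat_alg M).

Definition assemble_fun (v : lax_sum (pi_star_ob (can_lax M) N)) : N :=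
  \sum_(x : C) ideal_act (v x).

Lemma assemble_linear : linear assemble_fun.
Proof.
move=> c v w; rewrite /assemble_fun scaler_sumr -big_split.
by apply: eq_bigr => x _; rewrite /= linearP.
Qed.

HB.instance Definition _ :=
  GRing.isLinear.Build k (lax_sum (pi_star_ob (can_lax M) N)) N *:%R
    assemble_fun assemble_linear.

Lemma assemble_inj x (t : N ⊗ can_lax M x) :
  assemble_fun (@lax_inj k C M A (pi_star_ob (can_lax M) N) x t) = ideal_act t.
Proof.
rewrite /assemble_fun (bigD1 x) //= big1 => [|y ne].
  by rewrite addr0; congr ideal_act; exact: dinjE.
rewrite -[RHS](linear0 (@ideal_act N y)); congr ideal_act.
by apply: dinj_neq; rewrite eq_sym.
Qed.

Lemma assemble_lact a v : assemble_fun (lax_sum_lact a v) = lact a (assemble_fun v).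
Proof.
rewrite /assemble_fun (big_morph _ (lactDr a) (lact0 N a)).
by apply: eq_bigr => x _; exact: ideal_act_lact.
Qed.

Lemma assemble_ract v f : assemble_fun (lax_sum_ract v f) = ract (assemble_fun v) f.
Proof.
move: f; apply: mcat_ind => [|x y a m f IH].
  by rewrite lax_sum_ract0r linear0 ractr0.
rewrite lax_sum_ractDr linearD /= IH ractDr; congr (_ + _).
rewrite lax_sum_ract_homog assemble_inj -ideal_act_homog.
(* Only the summand at the source of a survives. *)
have -> : ract (assemble_fun v) (homog m : mcat_alg M) =
    \sum_z ract (ideal_act (v z)) (homog m : mcat_alg M).
  apply: (big_morph (fun n : N => ract n (homog m : mcat_alg M))); last exact: ract0.
  by move=> n n'; exact: ractDl.
by rewrite (bigD1 x) //= big1 ?addr0 // => y' ne; exact: ideal_act_homog_neq.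
Qed.

Definition assemble :
  bimod_hom (lax_sum_bimodule (pi_star_ob (can_lax M) N)) N :=
  @BimodHom k A (mcat_alg M) (lax_sum_bimodule (pi_star_ob (can_lax M) N)) N
    assemble_fun assemble_linear assemble_lact assemble_ract.

Lemma assemble_iso :
  is_cat_iso (assemble : @cat_hom (Bimod A (mcat_alg M)) _ N).
Proof.
pose g (n : N) : lax_sum (pi_star_ob (can_lax M) N) :=
  @dfam k C (fun x => (N ⊗ can_lax M x) : lmodType k)
    (fun x => pure n (ideal_gen M x)).
apply: (@bimod_cat_iso _ _ _ _ _ assemble g).
- move=> v; apply: dsumP => x; rewrite /= /assemble_fun (bigD1 x) //= pureDl.
  rewrite pure_ideal_act (big_morph (fun n => pure n (ideal_gen M x))
    (fun m n => pureDl m n _) (pure0l _ _)).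
  by rewrite big1 ?addr0 // => y ne; exact: pure_ideal_act_neq.
- move=> n; rewrite /= /assemble_fun.
  under eq_bigr => x _ do rewrite /= ideal_act_pure.
  rewrite -(big_morph (ract n) (ractDr n) (ractr0 n)); exact: ract1.
Qed.

End Component.
End Assembly.

(** * The 2-limit property *)

Lemma can_lax_2limit (k : comPzRingType) (C : finob_category)
    (M : pseudofunctor k C) : is_2limit (can_lax M).
Proof.
move=> A; exists (lax_sum_functor M A); split.
- exists (fun N => assemble N); split=> [N|N N' f]; first exact: assemble_iso.
  apply: bhom_ext => v; rewrite /= !bhomE /= /assemble_fun linear_sum.
  apply: eq_bigr => x _ /=; move: (v x); apply: tensor_ext => [s t|s t|n g].
  + by rewrite !linearD.
  + by rewrite !linearD.
  + by rewrite !bhomE !ideal_act_pure bhom_ract.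
- exists (fun V => counit V); split=> [V|V W T]; first exact: counit_iso.
  apply: modification_ext => x; apply: bhom_tensor_ext => v f.
  by rewrite /= !bhomE !counit_at_pure -lax_sum_map_ract.
Qed.

(** * Right modules as bimodules over the base ring *)

Section RightModules.
Variables (k : comPzRingType) (B : ualgType k).
Let R : pzRingType := ua_sort B.

Lemma scalar_central (c : k) (b : B) : b * (c *: (1 : B)) = c *: (1 : B) * b.
Proof. by rewrite -uscalerAl -uscalerAr mul1r mulr1. Qed.

Section ToBimodule.
Variable U : lmodType R^c.

(** An alias of U, so that its k-module structure does not compete with the
    structure of U over the converse ring of B. *)
Definition base_restriction : Type := U.
HB.instance Definition _ := GRing.Zmodule.on base_restriction.

(* The only possible choice: c m = m (c 1) in every bimodule over k. *)
Let scal (c : k) (u : U) : U := (c *: (1 : B) : R^c) *: u.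

Fact base_scalerA a b u : scal a (scal b u) = scal (a * b) u.
Proof.
rewrite /scal scalerA; congr (_ *: _).
by rewrite [LHS](_ : _ = (b *: (1 : B)) * (a *: (1 : B))) // -uscalerAl mul1r scalerA mulrC.
Qed.
Fact base_scale1r u : scal 1 u = u.
Proof. by rewrite /scal scale1r [LHS]scale1r. Qed.
Fact base_scalerDr : right_distributive scal +%R.
Proof. by move=> c u v; rewrite /scal scalerDr. Qed.
Fact base_scalerDl u : {morph scal^~ u : a b / a + b}.
Proof. by move=> a b; rewrite /scal scalerDl [LHS]scalerDl. Qed.

Fact base_scaler_act c u (b : R^c) : b *: scal c u = scal c (b *: u).
Proof.
by rewrite /scal !scalerA; congr (_ *: _); exact: (esym (scalar_central c b)).
Qed.
Fact scaled_act (c : k) (u : U) (b : B) :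
  (c *: b : R^c) *: u = scal c ((b : R^c) *: u).
Proof.
rewrite /scal scalerA; congr (_ *: _).
by rewrite [RHS](_ : _ = b * (c *: (1 : B))) // -uscalerAr mulr1.
Qed.

HB.instance Definition _ := GRing.Zmodule_isLmodule.Build k base_restriction
  base_scalerA base_scale1r base_scalerDr base_scalerDl.

Let act (u : base_restriction) (b : B) : base_restriction := (b : R^c) *: (u : U).

Definition bimodule_of_rmod : bimodule (base_ualg k) B.
Proof.
refine (@Bimodule k (base_ualg k) B base_restriction (fun c u => (c : k) *: u) act
  _ _ _ _ _ _ _ _ _ _ _ _ _).
- exact: (@scale1r k base_restriction).
- by move=> a b u; rewrite scalerA.
- by move=> a b u; rewrite scalerDl.
- by move=> a u v; rewrite scalerDr.
- by move=> c a u; rewrite scalerA.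
- by move=> c a u; rewrite !scalerA mulrC.
- by move=> u; exact: (@scale1r R^c U u).
- by move=> u a b; rewrite /act scalerA.
- by move=> u v a; exact: (@scalerDr R^c U).
- by move=> u a b; exact: (@scalerDl R^c U).
- by move=> c u b; exact: base_scaler_act.
- by move=> c u b; exact: scaled_act.
- by move=> c u b; exact: (esym (base_scaler_act c u b)).
Defined.

End ToBimodule.

Section OfBimodule.
Variable N : bimodule (base_ualg k) B.

Definition right_part : Type := N.
HB.instance Definition _ := GRing.Zmodule.on right_part.

Let scal (b : R^c) (n : N) : N := ract n (b : B).

Fact right_scalerA a b n : scal a (scal b n) = scal (a * b) n.
Proof. by rewrite /scal -ractM. Qed.
Fact right_scale1r n : scal 1 n = n.
Proof. exact: ract1. Qed.
Fact right_scalerDr : right_distributive scal +%R.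
Proof. by move=> b m n; exact: ractDl. Qed.
Fact right_scalerDl n : {morph scal^~ n : a b / a + b}.
Proof. by move=> a b; exact: ractDr. Qed.

HB.instance Definition _ := GRing.Zmodule_isLmodule.Build R^c right_part
  right_scalerA right_scale1r right_scalerDr right_scalerDl.

Definition rmod_of_bimodule : lmodType R^c := right_part.

End OfBimodule.

Section Maps.
Variables (U V : lmodType R^c) (f : {linear U -> V}).

Definition bimodule_map : bimod_hom (bimodule_of_rmod U) (bimodule_of_rmod V).
Proof.
refine (@BimodHom k (base_ualg k) B (bimodule_of_rmod U) (bimodule_of_rmod V) f _ _ _).
- by move=> c u v; exact: linearP.
- by move=> c u; exact: (linearZ_LR f).
- by move=> u b; exact: (linearZ_LR f).
Defined.
End Maps.

Section MapsBack.
Variables (N P : bimodule (base_ualg k) B) (f : bimod_hom N P).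

Definition right_part_map : rmod_of_bimodule N -> rmod_of_bimodule P := f.

Fact right_part_map_linear : linear right_part_map.
Proof.
move=> b m n; rewrite /right_part_map [LHS](linearD f) /=.
by congr (_ + _); exact: bhom_ract.
Qed.
HB.instance Definition _ := GRing.isLinear.Build R^c (rmod_of_bimodule N)
  (rmod_of_bimodule P) *:%R right_part_map right_part_map_linear.
Definition rmod_map : {linear rmod_of_bimodule N -> rmod_of_bimodule P} := right_part_map.
End MapsBack.

Program Definition rmod_to_bimod : cfunctor (RMod R) (Bimod (base_ualg k) B) :=
  @CFunctor (RMod R) (Bimod (base_ualg k) B) bimodule_of_rmod bimodule_map _ _.
Next Obligation. by move=> U; apply: bhom_ext => u; rewrite bhomE. Qed.
Next Obligation. by move=> U V W g f; apply: bhom_ext => u; rewrite bhomE. Qed.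

Program Definition bimod_to_rmod : cfunctor (Bimod (base_ualg k) B) (RMod R) :=
  @CFunctor (Bimod (base_ualg k) B) (RMod R) rmod_of_bimodule rmod_map _ _.
Next Obligation. by move=> N; apply: linear_ext => n; exact: bhom_idE. Qed.
Next Obligation.
by move=> N P Q g f; apply: linear_ext => n; exact: bhom_compE.
Qed.

Section RoundTrips.

Lemma base_scaler1 (N : bimodule (base_ualg k) B) (c : k) (n : N) :
  ract n (c *: (1 : B)) = c *: n.
Proof. by rewrite ractZr ract1. Qed.

Lemma base_lactE (N : bimodule (base_ualg k) B) (c : k) (n : N) :
  lact (c : base_ualg k) n = c *: n.
Proof.
have := @lactZl k (base_ualg k) B N c 1 n; rewrite lact1 => <-.
by congr lact; exact: (esym (mulr1 c)).
Qed.

Definition rmod_roundtrip_fun (U : lmodType R^c) :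
  rmod_of_bimodule (bimodule_of_rmod U) -> U := id.
Fact rmod_roundtrip_linear U : linear (@rmod_roundtrip_fun U).
Proof. by []. Qed.
HB.instance Definition _ U := GRing.isLinear.Build R^c
  (rmod_of_bimodule (bimodule_of_rmod U)) U *:%R (@rmod_roundtrip_fun U)
  (@rmod_roundtrip_linear U).

Definition rmod_roundtripV_fun (U : lmodType R^c) :
  U -> rmod_of_bimodule (bimodule_of_rmod U) := id.
Fact rmod_roundtripV_linear U : linear (@rmod_roundtripV_fun U).
Proof. by []. Qed.
HB.instance Definition _ U := GRing.isLinear.Build R^c
  U (rmod_of_bimodule (bimodule_of_rmod U)) *:%R (@rmod_roundtripV_fun U)
  (@rmod_roundtripV_linear U).

Definition rmod_roundtrip (U : lmodType R^c) :
  {linear rmod_of_bimodule (bimodule_of_rmod U) -> U} := @rmod_roundtrip_fun U.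
Definition rmod_roundtripV (U : lmodType R^c) :
  {linear U -> rmod_of_bimodule (bimodule_of_rmod U)} := @rmod_roundtripV_fun U.

Definition bimod_roundtrip (N : bimodule (base_ualg k) B) :
  bimod_hom (bimodule_of_rmod (rmod_of_bimodule N)) N.
Proof.
refine (@BimodHom k (base_ualg k) B (bimodule_of_rmod (rmod_of_bimodule N)) N id _ _ _).
- by move=> c m n; congr (_ + _); exact: base_scaler1.
- by move=> c n; rewrite [RHS](@base_lactE N); exact: base_scaler1.
- by [].
Defined.

End RoundTrips.

(** Both round trips leave the underlying group and the action of B as they are; on
    a bimodule the k-action is recovered because c m = m (c 1). *)
Lemma rmod_to_bimod_equivalence : is_equivalence rmod_to_bimod.
Proof.
exists bimod_to_rmod; split.
- exists rmod_roundtrip; split=> [U|U V f].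
    exists (rmod_roundtripV U).
    by split; apply: linear_ext.
  exact: linear_ext.
- exists bimod_roundtrip; split=> [N|N P f].
    by apply: (@bimod_cat_iso _ _ _ _ _ (bimod_roundtrip N) id) => n.
  apply: (@bhom_ext _ _ _ (bimodule_of_rmod (rmod_of_bimodule N)) P) => n.
  by rewrite /= !bhomE.
Qed.

End RightModules.

(** * Modulated and comodulated category algebras *)

Lemma category_algebra_2limit (k : comPzRingType) (C : finob_category)
    (M : pseudofunctor k C) :
  [/\ is_ualgebra (mcat_one M) (@mcat_mul k C M), is_2limit (can_lax M) &
      equivalent_categories (RMod (mcat_alg M)) (Rep M)].
Proof.
split; [exact: mcat_axioms | exact: can_lax_2limit |].
exists (cfunctor_comp (pi_star (can_lax M) (base_ualg k)) (rmod_to_bimod (mcat_alg M))).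
apply: is_equivalence_comp; first exact: rmod_to_bimod_equivalence.
exact: can_lax_2limit.
Qed.

Theorem theoremA (k : comPzRingType) (C : finob_category) :
  (forall M : modulation k C,
     [/\ is_ualgebra (mcat_one M) (@mcat_mul k C M),
         is_2limit (can_lax M) &
         equivalent_categories (RMod (mcat_alg M)) (Rep M)])
  /\
  (forall W : comodulation k C,
     [/\ is_ualgebra (comcat_one W) (@comcat_mul k C W),
         is_2limit (co_can_lax W) &
         equivalent_categories (RMod (comcat_alg W)) (Rep W)]).
Proof.
split=> [M|W]; first exact: category_algebra_2limit.
exact: (@category_algebra_2limit k (fc_op C)).
Qed.
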